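(* Consider the outlier detection bandit problem with $n$ arms and threshold $\theta=\mu_y+k\sigma_y$; let $\Delta_i=|y_i-\theta|$ for $i\in[n]$ and $\Delta_{\min}=\min_{i\in[n]}\Delta_i$. With probability at least $1-\delta$, the total number of samples of the Adaptive Double Exploration (ADE) algorithm run with confidence parameter $\delta$ is bounded by $$O\Bigg(\sum_{i=1}^n\frac{1}{\Delta_i^2}\log\Big(\sqrt{\tfrac{n}{\delta}}\,\tfrac{1}{\Delta_i^2}\max\{1,(\tfrac{k}{\sigma_y})^2\}\Big)+\max\{1,(\tfrac{k}{\sigma_y})^2\}\frac{1}{\Delta_{\min}^2}\log\Big(\sqrt{\tfrac{n}{\delta}}\,\tfrac{1}{\Delta_{\min}^2}\max\{1,(\tfrac{k}{\sigma_y})^2\}\Big)\Bigg).$$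
   Context: **Problem.** There are $n$ arms $[n]=\{1,\dots,n\}$. The reward distribution of arm $i$ is bounded in $[a,b]$ with $a\ge 0$ and has mean $y_i$ (unknown to the learner). Each pull of arm $i$ yields a sample from its distribution, independent of the past pulls. Put $R=b-a$, $R'=b^2-a^2$, $\mu_y=\frac1n\sum_{i=1}^n y_i$, $\sigma_y=\sqrt{\frac1n\sum_{i=1}^n(y_i-\mu_y)^2}$, and $\theta=\mu_y+k\sigma_y$, where $k$ is a given constant. The outlier set, which the algorithm is to identify, is $\{i\in[n]:y_i\ge\theta\}$. **Two kinds of sampling.** *Random sample for the threshold*: choose an arm uniformly at random from $[n]$ and pull it twice independently; the $l$-th such sample gives a pair $(x_{l,1},x_{l,2})$. *Sequential sample*: pull once each arm in the current candidate set; the $l$-th sequential pull of arm $i$ gives reward $y_{i,l}$. **Estimators and radii.** $m_{\theta,t}$ and $m_{a,t}$ are the numbers of random samples and of sequential samples performed prior to round $t$, and $m_{i,t}$ is the number of sequential pulls of arm $i$ prior to round $t$ (so $m_{i,t}=m_{a,t}$ while $i$ is a candidate). Let $\delta_t=\frac{3\delta}{(n+4)\pi^2t^2}$, and, with $m=m_{\theta,t}$, $$\hat y_{i,t}=\frac1{m_{i,t}}\sum_{l=1}^{m_{i,t}}y_{i,l},\qquad \hat\mu_{y,t}=\frac1m\sum_{l=1}^m x_{l,1},$$ $$\hat\sigma_{y,t}=\sqrt{\Big|\frac1m\sum_{l=1}^m x_{l,1}x_{l,2}-\frac1{m^2}\sum_{l=1}^m\sum_{h=1}^m x_{l,1}x_{h,2}\Big|},\qquad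 \hat\theta_t=\hat\mu_{y,t}+k\hat\sigma_{y,t},$$ $$r_{i,t}=R\sqrt{\frac{\log(1/\delta_t)}{2m_{i,t}}},\qquad r_{a,t}=R\sqrt{\frac{\log(1/\delta_t)}{2m_{a,t}}},\qquad \epsilon_{\sigma,t}=(R'+2bR)\sqrt{\frac{\log(1/\delta_t)}{2m_{\theta,t}}},$$ $$U_{\sigma,t}=\min_{1\le\tau\le t}\{\hat\sigma_{y,\tau}^2+\epsilon_{\sigma,\tau}\},\qquad r_{\theta,t}=\Big(R+\sqrt2\,k\,\frac{R'+2bR}{\sqrt{U_{\sigma,t}}}\Big)\sqrt{\frac{\log(1/\delta_t)}{2m_{\theta,t}}},$$ where expressions with a zero sample count in the denominator are read as $+\infty$ (so they do not affect the minimum). **ADE algorithm.** Initialize $N=O=\emptyset$, $t=1$, $m_{\theta,1}=m_{a,1}=0$. Perform one random sample and increment $t$; then perform one sequential sample with candidate set $[n]$ and increment $t$; set $S_t=[n]$. While $S_t\ne\emptyset$: if $r_{a,t}\le r_{\theta,t}$, perform one random sample (from all $n$ arms); otherwise perform one sequential sample on the candidate set $S_t$. Increment $t$ by one, and update the estimators and radii. Then, starting from $S_t=S_{t-1}$, for each $i\in S_{t-1}$: if $\hat y_{i,t}+r_{i,t}\le\hat\theta_t-r_{\theta,t}$, add $i$ to $N$ (normal arms) and remove it from $S_t$; else if $\hat y_{i,t}-r_{i,t}\ge\hat\theta_t+r_{\theta,t}$, add $i$ to $O$ (outliers) and remove it from $S_t$. When $S_t=\emptyset$, stop and return $O$.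
   Formalization: Each log in the bound is read as max{1, log}, since the bare logs can be negative; k is taken nonnegative, since for negative k the algorithm may never halt; all gaps Δ_i are positive; the O-constant depends on a, b and an upper bound on k. *)

(* Defs.v *)
From mathcomp Require Import all_boot all_order all_algebra.
From mathcomp Require Import all_classical all_reals all_analysis.
Set Implicit Arguments.
Unset Strict Implicit.
Unset Printing Implicit Defensive.
Import Order.TTheory GRing.Theory Num.Theory.
Import numFieldNormedType.Exports.

Local Open Scope classical_set_scope.
Local Open Scope ring_scope.

(* "The event E has probability at least p", without presupposing that E is
   measurable; for a measurable E this is p%:E <= P E. *)
Definition with_probability_at_least (R : realType) (d : measure_display)
    (T : measurableType d) (P : probability T R) (p : R) (E : set T) : Prop :=
  exists G : set T, [/\ measurable G, G `<=` E & (p%:E <= P G)%E].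

(* When every class F i is a pi-system containing setT, this is the mutual
   independence of the generated sigma-algebras. *)
Definition mutually_independent (R : realType) (d : measure_display)
    (T : measurableType d) (P : probability T R) (I : choiceType)
    (F : I -> set (set T)) : Prop :=
  forall (s : seq I) (E : I -> set T), uniq s -> (forall i, i \in s -> F i (E i)) ->
    P (\bigcap_(i in [set` s]) E i) = (\prod_(i <- s) P (E i))%E.

(* The l-th random sample (l >= 0)
   chooses the arm [arm l] and yields the pair (x1 l, x2 l); the l-th sequential
   pull of arm i yields y i l. *)
Definition sample_events (R : realType) (d : measure_display)
    (T : measurableType d) (P : probability T R) (n : nat)
    (arm : nat -> T -> 'I_n) (x1 x2 : nat -> {RV P >-> R})
    (y : 'I_n -> nat -> {RV P >-> R}) (j : nat + 'I_n * nat) : set (set T) :=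
  match j with
  | inl l => [set E | exists (D : set 'I_n) (A B : set (measurableTypeR R)),
      [/\ measurable A, measurable B &
          E = arm l @^-1` D `&` (x1 l @^-1` A `&` x2 l @^-1` B)]]
  | inr (i, l) => [set E | exists2 A : set (measurableTypeR R),
      measurable A & E = y i l @^-1` A]
  end.

Record sampling_model (R : realType) (d : measure_display)
    (T : measurableType d) (P : probability T R) (n : nat)
    (nu : 'I_n -> probability (measurableTypeR R) R)
    (arm : nat -> T -> 'I_n) (x1 x2 : nat -> {RV P >-> R})
    (y : 'I_n -> nat -> {RV P >-> R}) : Prop := SamplingModel {
  arm_measurable : forall l i, measurable (arm l @^-1` [set i]);
  (* a uniformly chosen arm, pulled twice independently *)
  random_sample_law : forall l i (A B : set (measurableTypeR R)),
    measurable A -> measurable B ->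
    P (arm l @^-1` [set i] `&` (x1 l @^-1` A `&` x2 l @^-1` B)) =
    ((n%:R^-1)%:E * (nu i A * nu i B))%E;
  sequential_law : forall i l (A : set (measurableTypeR R)),
    measurable A -> P (y i l @^-1` A) = nu i A;
  samples_independent : mutually_independent P (sample_events arm x1 x2 y) }.

Definition arm_mean (R : realType) (n : nat)
    (nu : 'I_n -> probability (measurableTypeR R) R) (i : 'I_n) : R :=
  \int[nu i]_x x.

Definition supported_in (R : realType) (a b : R)
    (m : probability (measurableTypeR R) R) : Prop :=
  m `[a, b]%classic = 1%E.

Definition mu_arms (R : realType) (n : nat) (y : 'I_n -> R) : R :=
  n%:R^-1 * \sum_(i < n) y i.

Definition sigma_arms (R : realType) (n : nat) (y : 'I_n -> R) : R :=
  Num.sqrt (n%:R^-1 * \sum_(i < n) (y i - mu_arms y) ^+ 2).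

Definition threshold (R : realType) (n : nat) (k : R) (y : 'I_n -> R) : R :=
  mu_arms y + k * sigma_arms y.

Definition gap (R : realType) (n : nat) (k : R) (y : 'I_n -> R) (i : 'I_n) : R :=
  `|y i - threshold k y|.

Definition gap_min (R : realType) (n : nat) (n_gt0 : (0 < n)%N) (k : R)
    (y : 'I_n -> R) : R :=
  \big[Num.min/gap k y (Ordinal n_gt0)]_(i < n) gap k y i.

Record ade_state (R : realType) (n : nat) := AdeState {
  round : nat;                    (* t *)
  mtheta : nat;                   (* m_{theta,t} *)
  mseq : nat;                     (* m_{a,t} *)
  marm : {ffun 'I_n -> nat};      (* m_{i,t} *)
  usigma : \bar R;                (* U_{sigma,t}, as a running minimum *)
  cand : {set 'I_n};              (* S_t *)
  normals : {set 'I_n};           (* N *)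
  outliers : {set 'I_n} }.        (* O *)

(* The algorithm is run on one realization of the samples: x1, x2, y below are
   the values at a fixed outcome; sums over l < m are over the first m samples. *)
Section ADE.
Variables (R : realType) (n : nat) (a b k delta : R).
Variables (x1 x2 : nat -> R) (y : 'I_n -> nat -> R).
Implicit Types (st : ade_state R n) (t m : nat).

Definition delta_at t : R :=
  3 * delta / ((n%:R + 4) * pi ^+ 2 * t%:R ^+ 2).

Definition confidence t m : R :=
  Num.sqrt (ln (1 / delta_at t) / (2 * m%:R)).

Definition range1 : R := b - a.
Definition range2 : R := b ^+ 2 - a ^+ 2.

Definition y_hat (i : 'I_n) m : R := m%:R^-1 * \sum_(l < m) y i l.

Definition mu_hat m : R := m%:R^-1 * \sum_(l < m) x1 l.

Definition sigma_hat m : R :=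
  Num.sqrt `| m%:R^-1 * (\sum_(l < m) x1 l * x2 l)
              - (m%:R ^+ 2)^-1 * \sum_(l < m) \sum_(h < m) x1 l * x2 h |.

Definition theta_hat m : R := mu_hat m + k * sigma_hat m.

Definition eps_sigma t m : R := (range2 + 2 * b * range1) * confidence t m.

(* Sample counts may be zero only here among the quantities the algorithm reads. *)
Definition usigma_term t m : \bar R :=
  if m == 0%N then +oo%E else (sigma_hat m ^+ 2 + eps_sigma t m)%:E.

Definition r_arm st (i : 'I_n) : R := range1 * confidence (round st) (marm st i).

Definition r_seq st : R := range1 * confidence (round st) (mseq st).

(* Evaluated only from round 3 on, where all the counts involved are positive
   and usigma is finite. *)
Definition r_theta st : R :=
  (range1 + Num.sqrt 2 * k *
     ((range2 + 2 * b * range1) / Num.sqrt (fine (usigma st))))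
  * confidence (round st) (mtheta st).

Definition random_sample st : ade_state R n :=
  let t := (round st).+1 in
  let m := (mtheta st).+1 in
  AdeState t m (mseq st) (marm st)
    (Order.min (usigma st) (usigma_term t m))
    (cand st) (normals st) (outliers st).

Definition sequential_sample st : ade_state R n :=
  let t := (round st).+1 in
  AdeState t (mtheta st) (mseq st).+1
    [ffun i => (marm st i + (i \in cand st))%N]
    (Order.min (usigma st) (usigma_term t (mtheta st)))
    (cand st) (normals st) (outliers st).

Definition is_normal st (i : 'I_n) : bool :=
  y_hat i (marm st i) + r_arm st i <= theta_hat (mtheta st) - r_theta st.

Definition is_outlier st (i : 'I_n) : bool :=
  y_hat i (marm st i) - r_arm st i >= theta_hat (mtheta st) + r_theta st.

Definition classify st : ade_state R n :=
  let nw := [set i in cand st | is_normal st i]%SET in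
  let ow := [set i in cand st | ~~ is_normal st i && is_outlier st i]%SET in
  AdeState (round st) (mtheta st) (mseq st) (marm st) (usigma st)
    (cand st :\: (nw :|: ow))%SET (normals st :|: nw)%SET (outliers st :|: ow)%SET.

Definition ade_start : ade_state R n :=
  AdeState 1 0 0 [ffun=> 0%N] (usigma_term 1 0) [set: 'I_n]%SET finset.set0 finset.set0.

Definition ade_init : ade_state R n := sequential_sample (random_sample ade_start).

Definition loop_body st : ade_state R n :=
  classify (if r_seq st <= r_theta st then random_sample st
            else sequential_sample st).

(* The state after s iterations of the loop, constant once the loop has exited. *)
Definition ade_run (s : nat) : ade_state R n :=
  iter s (fun st => if cand st == finset.set0 then st else loop_body st) ade_init.

(* Number of pulls made so far: two for each random sample, and one per
   candidate arm for each sequential sample. *)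
Definition num_samples st : nat := (2 * mtheta st + \sum_(i < n) marm st i)%N.

Definition halts_within (B : R) : Prop :=
  exists s, cand (ade_run s) = finset.set0 /\ (num_samples (ade_run s))%:R <= B.

End ADE.

(* The logarithms in the bound are taken to be at least 1: on [a, b] with b - a
   large their arguments may be at most 1, and then the bare sum is not positive. *)
Definition log1 (R : realType) (x : R) : R := Num.max 1 (ln x).

Definition kappa (R : realType) (n : nat) (k : R) (y : 'I_n -> R) : R :=
  Num.max 1 ((k / sigma_arms y) ^+ 2).

Definition ade_bound (R : realType) (n : nat) (n_gt0 : (0 < n)%N)
    (k delta : R) (y : 'I_n -> R) : R :=
  let L (D : R) :=
    log1 (Num.sqrt (n%:R / delta) * (1 / D ^+ 2) * kappa k y) in
  \sum_(i < n) 1 / gap k y i ^+ 2 * L (gap k y i)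
  + kappa k y * (1 / gap_min n_gt0 k y ^+ 2) * L (gap_min n_gt0 k y).

(* Main.v *)
Require Import Defs.
From mathcomp Require Import all_boot all_order all_algebra.
From mathcomp Require Import all_classical all_reals all_analysis.
From mathcomp Require Import measurable_realfun ring lra zify.
Set Implicit Arguments.
Unset Strict Implicit.
Unset Printing Implicit Defensive.
Import Order.TTheory GRing.Theory Num.Theory.
Import numFieldNormedType.Exports.
Local Open Scope classical_set_scope.
Local Open Scope ring_scope.

(* The concentration event bounds, for every sample count m at once, the deviation of
   each estimator from its mean by a fixed multiple of its confidence radius at round m.
   Since the round t is at least every sample count and the radii increase with t, this
   controls the estimators at the data-dependent counts of the algorithm; the slack in
   the multiple pays for the union bound over m.  On this event U_sigma is at least
   sigma^2 / 12, hence r_theta is of order sqrt kappa times sqrt (log (1/delta_t) / m_theta),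
   and |theta_hat - theta| <= 7 r_theta because D = |sigma_hat - sigma| satisfies both
   D (sigma_hat + sigma) <= 6 eps and D^2 <= 6 eps.  So an arm i is still undecided only
   if Delta_i <= 7 r_i + 8 r_theta.  The algorithm always shrinks the larger of the two
   radii, so each random sample is taken while Delta_min <= 15 r_theta and each sequential
   pull of i while Delta_i <= 15 r_i; moreover m_theta <= C kappa m_a + 1 and
   m_a <= m_theta, so that t in log (1/delta_t) can be replaced by a multiple of the count
   being bounded, and the inequalities m <= A log (B m) can be solved for m. *)

(** * Integrals of products and concentration of means *)

Section Factorization.
Context (R : realType) (d : measure_display) (T : measurableType d).
Context (P : {measure set T -> \bar R}).
Import HBNNSimple.

(** The hypothesis is the conclusion for an indicator [f]. Linearity gives it for the simple
    functions [g n], and monotone convergence for their limit [f]. *)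
Lemma integral_factor_comp (d' : measure_display) (T' : measurableType d')
    (m : {measure set T' -> \bar R}) (W : T -> R) (X : T -> T') (c : R) (f : T' -> R) :
  measurable_fun setT W -> (forall t, 0 <= W t) -> measurable_fun setT X ->
  0 <= c ->
  (forall A, measurable A ->
     (\int[P]_t (W t * \1_A (X t))%:E = c%:E * m A)%E) ->
  measurable_fun setT f -> (forall x, 0 <= f x) ->
  (\int[P]_t (W t * f (X t))%:E = c%:E * \int[m]_x (f x)%:E)%E.
Proof.
move=> mW W0 mX c0 H mf f0.
have /measurable_EFinP mEf := mf.
pose g := nnsfun_approx measurableT mEf.
have gf x : (g n x)%:E @[n --> \oo] --> (f x)%:E.
  by apply: cvg_nnsfun_approx => // y _; rewrite lee_fin.
have mWg n : measurable_fun setT (fun t => (W t * g n (X t))%:E).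
  apply/measurable_EFinP; apply: measurable_funM => //.
  exact: measurableT_comp.
transitivity (limn (fun n => \int[P]_t (W t * g n (X t))%:E))%E.
  rewrite -monotone_convergence//; last 2 first.
  - by move=> n t _; rewrite lee_fin mulr_ge0.
  - move=> t _ i j ij; rewrite lee_fin ler_wpM2l//.
    exact/lefP/nd_nnsfun_approx.
  apply: eq_integral => t _; apply/esym/cvg_lim => //.
  under eq_fun do rewrite EFinM.
  by rewrite EFinM; apply: cvgeZl => //; exact: gf.
transitivity (limn (fun n => c%:E * \int[m]_x (g n x)%:E))%E; last first.
  apply/cvg_lim => //; apply: cvgeZl => //.
  rewrite (_ : (\int[m]_x (f x)%:E = \int[m]_x limn (fun n => (g n x)%:E))%E).
    apply: cvg_monotone_convergence => //.
    - by move=> n; exact/measurable_EFinP.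
    - by move=> n x _; rewrite lee_fin.
    - by move=> x _ i j ij; rewrite lee_fin; exact/lefP/nd_nnsfun_approx.
  by apply: eq_integral => x _; apply/esym/cvg_lim => //; exact: gf.
congr (limn _); apply/funext => n.
have mgn r : measurable (g n @^-1` [set r]) by [].
have ind0 y x : 0 <= y * \1_(g n @^-1` [set y]) x.
  by have := nnfun_muleindic_ge0 (g n) y x; rewrite lee_fin.
have mX1 y : measurable_fun setT (fun t => y * (W t * \1_(g n @^-1` [set y]) (X t))).
  apply: measurable_funM => //; apply: measurable_funM => //.
  exact: measurableT_comp.
transitivity (\sum_(y \in range (g n))
    \int[P]_t (y * (W t * \1_(g n @^-1` [set y]) (X t)))%:E)%E.
  rewrite -ge0_integral_fsum//.
  - apply: eq_integral => t _; rewrite fsumEFin//; congr EFin.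
    rewrite fimfunE mulr_fsumr; apply: eq_fsbigr => y _; exact: mulrCA.
  - by move=> y; exact/measurable_EFinP.
  - by move=> y t _; rewrite lee_fin mulrCA mulr_ge0.
under [in RHS]eq_integral do rewrite fimfunE -fsumEFin//.
rewrite ge0_integral_fsum//; last 2 first.
- by move=> y; exact/measurable_EFinP/measurable_funM.
- by move=> y x _; rewrite lee_fin.
rewrite ge0_mule_fsumr; last first.
  by move=> y; apply: integral_ge0 => x _; rewrite lee_fin.
apply: eq_fsbigr => y; rewrite inE => -[x _ yE].
have y0 : 0 <= y by rewrite -yE.
under eq_integral do rewrite EFinM.
rewrite ge0_integralZl_EFin//; last 2 first.
- by move=> t _; rewrite lee_fin mulr_ge0.
- apply/measurable_EFinP/measurable_funM => //; exact: measurableT_comp.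
rewrite H// integralZl_indic_nnsfun// integral_indic// setIT.
by rewrite muleCA.
Qed.
End Factorization.

Section Factors.
Context (R : realType) (d : measure_display) (T : measurableType d).
Context (P : probability T R).

(* Integrals of products factor over every weight [W] whose mean factors over the events
   of [F].  Only the events of [F], not those of the sigma-algebra they generate, are
   tested, so the product formula needs no pi-lambda argument. *)
Definition factors (F : set (set T)) (h : T -> R) (e : R) : Prop :=
  [/\ measurable_fun setT h, forall t, 0 <= h t, 0 <= e &
      forall (W : T -> R) (c : R),
        measurable_fun setT W -> (forall t, 0 <= W t) -> 0 <= c ->
        (forall E, F E -> (\int[P]_t (W t * \1_E t)%:E = c%:E * P E)%E) ->
        (\int[P]_t (W t * h t)%:E = (c * e)%:E)%E].

Lemma factors_integral F h e : F `<=` measurable -> factors F h e ->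
  (\int[P]_t (h t)%:E = e%:E)%E.
Proof.
move=> mF [_ _ _ /(_ (cst 1) 1)].
rewrite mul1r => <- //; first by under [RHS]eq_integral do rewrite /= mul1r.
move=> E FE; under eq_integral do rewrite /= mul1r.
by rewrite mul1e integral_indic ?setIT//; exact: mF.
Qed.

(** The Chernoff bound below multiplies affine functions of the samples instead of exponentials;
    [factors] passes to them by linearity. *)
Lemma factors_affine F h e (q : R) : F setT -> factors F h e ->
  (forall t, 0 <= 1 + q * h t) -> 0 <= 1 + q * e ->
  factors F (fun t => 1 + q * h t) (1 + q * e).
Proof.
move=> FT [mh h0 e0 fh] qh0 qe0; split => //.
  by apply: measurable_funD => //; exact: measurable_funM.
move=> W c mW W0 c0 HW.
have WT : (\int[P]_t (W t)%:E = c%:E)%E.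
  have := HW _ FT; rewrite probability_setT mule1 => <-.
  by apply: eq_integral => t _; rewrite indicT mulr1.
have Wh := fh W c mW W0 c0 HW.
have mWh : measurable_fun setT (fun t => (W t * h t)%:E).
  by apply/measurable_EFinP; exact: measurable_funM.
have mWq : measurable_fun setT (fun t => (W t * (1 + q * h t))%:E).
  apply/measurable_EFinP; apply: measurable_funM => //.
  by apply: measurable_funD => //; exact: measurable_funM.
have [q0|/ltW q0] := leP 0 q.
  under eq_integral do rewrite mulrDr mulr1 mulrCA EFinD (EFinM q).
  rewrite ge0_integralD//; last 4 first.
  - by move=> t _; rewrite lee_fin.
  - exact/measurable_EFinP.
  - by move=> t _; rewrite -EFinM lee_fin !mulr_ge0.
  - exact: measurable_funeM.
  rewrite ge0_integralZl_EFin//; last by move=> t _; rewrite lee_fin mulr_ge0.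
  by rewrite WT Wh -EFinM -EFinD mulrDr mulr1 mulrCA.
(* For negative [q] the term [q * h] is not nonnegative, so [- q] times the integral of [W * h],
   which is finite, is added first and cancelled afterwards. *)
have : (\int[P]_t (W t * (1 + q * h t))%:E + (- q)%:E * \int[P]_t (W t * h t)%:E
    = c%:E)%E.
  rewrite -ge0_integralZl_EFin//; last 2 first.
  - by move=> t _; rewrite lee_fin mulr_ge0.
  - by rewrite oppr_ge0.
  rewrite -ge0_integralD//; last 3 first.
  - by move=> t _; rewrite lee_fin mulr_ge0.
  - by move=> t _; rewrite -EFinM lee_fin !mulr_ge0// oppr_ge0.
  - exact: measurable_funeM.
  rewrite -WT; apply: eq_integral => t _.
  by rewrite -EFinM -EFinD; congr EFin; ring.
rewrite Wh -EFinM.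
case: (\int[P]_t _)%E => [r| |]//; rewrite -EFinD => -[rE]; congr EFin.
by rewrite mulrDr mulr1 -[X in X + _]rE; ring.
Qed.

Lemma factors_prod (I : choiceType) (F : I -> set (set T)) (h : I -> T -> R)
    (e : I -> R) (s : seq I) :
  mutually_independent P F -> (forall i, F i `<=` measurable) ->
  uniq s -> (forall i, i \in s -> factors (F i) (h i) (e i)) ->
  (\int[P]_t (\prod_(i <- s) h i t)%:E = (\prod_(i <- s) e i)%:E)%E.
Proof.
move=> indF mF us fs.
(* Generalized for the induction on [s]: samples in [s] enter through functions, those in [r]
   through events, and each step turns one event into a function. *)
suff main : forall (r : seq I) (E : I -> set T), uniq (s ++ r) ->
    (forall i, i \in r -> F i (E i)) ->
    (\int[P]_t (\prod_(i <- s) h i t * \prod_(i <- r) \1_(E i) t)%:E =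
     (\prod_(i <- s) e i)%:E * \prod_(i <- r) P (E i))%E.
  have := main [::] (fun=> setT); rewrite cats0 big_nil mule1 => <- //.
  by apply: eq_integral => t _; rewrite big_nil mulr1.
elim: s us fs => [_ _ r E ur FE|j s IH /= /andP[js us] fs r E /andP[jsr usr] FE].
  rewrite big_nil mul1e -indF//.
  rewrite -[in RHS](setIT (\bigcap_(_ in _) _)) -integral_indic//; last first.
    by rewrite bigcap_seq big_seq; apply: bigsetI_measurable => i ir; apply/(mF i)/FE.
  apply: eq_integral => t _; rewrite big_nil mul1r; congr EFin.
  rewrite bigcap_seq; elim: r {ur FE} => [|i r IHr]; first by rewrite !big_nil indicT.
  by rewrite !big_cons IHr indicI.
have [mh h0 e0 fj] := fs j (mem_head _ _).
have fs' i : i \in s -> factors (F i) (h i) (e i).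
  by move=> si; apply: fs; rewrite in_cons si orbT.
pose W t := \prod_(i <- s) h i t * \prod_(i <- r) \1_(E i) t : R.
under eq_integral => t _.
  rewrite big_cons -mulrA mulrC -/(W t); over.
have Pr : (\prod_(i <- r) P (E i) = (\prod_(i <- r) fine (P (E i)))%:E)%E.
  rewrite -prodEFin; apply: eq_big_seq => i ir.
  by rewrite fineK// fin_num_measure//; apply/(mF i)/FE.
rewrite Pr big_cons (fj W (\prod_(i <- s) e i * \prod_(i <- r) fine (P (E i)))).
- by rewrite -EFinM; congr EFin; ring.
- apply: measurable_funM; apply: measurable_prod => i ir.
    by have [] := fs' i ir.
  by apply: measurable_indic; apply/(mF i)/FE.
- move=> t; apply: mulr_ge0; rewrite big_seq; apply: prodr_ge0 => i.
    by move=> /fs'[].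
  by rewrite indicE.
- apply: mulr_ge0; rewrite big_seq; apply: prodr_ge0 => i; first by move=> /fs'[].
  by rewrite fine_ge0.
(* The product formula for the weight [W] against [A] is the induction hypothesis with [j] moved to
   the list of events, where it carries [A]. *)
- move=> A FA.
  pose E' i := if i == j then A else E i.
  have E'E i : i \in r -> E' i = E i.
    move=> ir; rewrite /E'; case: eqP => // ij.
    by move: jsr; rewrite mem_cat -ij ir orbT.
  have E'j : E' j = A by rewrite /E' eqxx.
  have -> : (\int[P]_t (W t * \1_A t)%:E = \int[P]_t (\prod_(i <- s) h i t *
      \prod_(i <- j :: r) \1_(E' i) t)%:E)%E.
    apply: eq_integral => t _; rewrite big_cons E'j; congr EFin.
    have -> : \prod_(i <- r) \1_(E' i) t = \prod_(i <- r) \1_(E i) t :> R.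
      by apply: eq_big_seq => i ir; rewrite E'E.
    by rewrite /W; ring.
  rewrite IH//; last 2 first.
  + by rewrite -cat1s uniq_catCA cat1s /= jsr usr.
  + move=> i; rewrite in_cons; have [->|ij] := eqVneq i j; first by rewrite E'j.
    by move=> /= ir; rewrite E'E//; exact: FE.
  rewrite big_cons E'j; have -> : (\prod_(i <- r) P (E' i) = \prod_(i <- r) P (E i))%E.
    by apply: eq_big_seq => i ir; rewrite E'E.
  by rewrite Pr EFinM -muleA (muleC (P A)).
Qed.
End Factors.

Section Tail.
Context (R : realType).

(** Multiply by [1 - x > 0]: on the left [expR x * (1 - x) <= expR x * expR (- x) = 1], on the right
    [1 + x^2 (1 - 2x) >= 1]. *)
Lemma expR_le_quadratic (x : R) : x <= 2^-1 -> expR x <= 1 + x + 2 * x ^+ 2.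
Proof.
move=> xh; have x1 : 0 < 1 - x by lra.
rewrite -(ler_pM2l x1); apply: (@le_trans _ _ 1).
  rewrite -[leRHS](expRxMexpNx_1 x) mulrC ler_wpM2l ?expR_ge0//.
  by have := expR_ge1Dx (- x).
have -> : (1 - x) * (1 + x + 2 * x ^+ 2) = 1 + x ^+ 2 * (1 - 2 * x) by ring.
by rewrite lerDl mulr_ge0 ?sqr_ge0//; lra.
Qed.

(* Combining the tangent inequality [1 + u <= expR u] at [u = - (q * z)] and at
   [u = q * (1 - z)]. *)
Lemma expR_le_chord (q z : R) : 0 <= z <= 1 -> expR (q * z) <= 1 + (expR q - 1) * z.
Proof.
move=> /andP[z0 z1].
have h0 : expR (q * z) * (1 - q * z) <= 1.
  by rewrite -[leRHS](expRxMexpNx_1 (q * z)) ler_wpM2l ?expR_ge0//; have := expR_ge1Dx (- (q * z)).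
have h1 : expR (q * z) * (1 + q * (1 - z)) <= expR q.
  rewrite [X in _ <= expR X](_ : q = q * z + q * (1 - z)); last by ring.
  by rewrite expRD ler_wpM2l ?expR_ge0// expR_ge1Dx.
have {}h0 := ler_wpM2l (_ : 0 <= 1 - z) h0.
have {}h1 := ler_wpM2l z0 h1.
have : 0 <= 1 - z by lra.
move=> /h0; nra.
Qed.

Context (d : measure_display) (T : measurableType d) (P : probability T R).

Lemma mutually_independent_comp (I J : choiceType) (F : I -> set (set T))
    (s : J -> I) (r : I -> J) : cancel s r ->
  mutually_independent P F -> mutually_independent P (F \o s).
Proof.
move=> sK indF js E ujs FE.
have := indF (map s js) (E \o r); rewrite big_map bigcap_seq big_map.
rewrite map_inj_uniq; last exact: can_inj sK.
rewrite bigcap_seq; under eq_bigr do rewrite /= sK.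
under [in RHS]eq_bigr do rewrite /= sK.
by apply => // _ /mapP[j jjs ->]; rewrite /= sK; exact: FE.
Qed.

(** Chernoff bound for variables in [0, 1], with both signs [u] treated at once. The chord bounds
    [expR (q * Z)] by an affine function of [Z], so the expected product is at most
    [(1 + (expR q - 1) p)^m], which depends on the mean [p] alone. *)
Lemma mean_tail (F : nat -> set (set T)) (Z : nat -> T -> R) (p u s : R) (m : nat) :
  mutually_independent P F -> (forall l, F l `<=` measurable) ->
  (forall l, F l setT) -> (forall l, factors P (F l) (Z l) p) ->
  (forall l t, Z l t <= 1) -> (u == 1) || (u == -1) -> (0 < m)%N -> 0 <= s ->
  (P [set t | (s <= u * (m%:R^-1 * \sum_(l < m) Z l t - p))%R]
     <= (expR (- (m%:R * s ^+ 2 / 8)))%:E)%E.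
Proof.
move=> indF mF FT fZ Z1 u1 m0 s0.
have Z0 l t : 0 <= Z l t by have [_ + _ _] := fZ l.
have mZ l : measurable_fun setT (Z l) by have [+ _ _ _] := fZ l.
have p0 : 0 <= p by have [_ _ + _] := fZ 0%N.
have p1 : p <= 1.
  rewrite -lee_fin -(factors_integral (mF 0%N) (fZ 0%N)).
  apply: (@le_trans _ _ (\int[P]_t (cst 1 t))%E).
    apply: ge0_le_integral => //.
    - by move=> t _; rewrite lee_fin.
    - exact/measurable_EFinP.
    - by move=> t _; rewrite lee_fin.
  by rewrite integral_cst// mul1e [leLHS]probability_setT.
have mR : 0 < m%:R :> R by rewrite ltr0n.
set S := fun t => \sum_(l < m) Z l t.
have S0 t : 0 <= S t by apply: sumr_ge0.
have Sm t : S t <= m%:R.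
  rewrite -[leRHS]mulr1 mulr_natl -[in leRHS](card_ord m) -sumr_const.
  by apply: ler_sum.
have mean1 t : 0 <= m%:R^-1 * S t <= 1.
  by rewrite (mulrC _ (S t)) divr_ge0 ?ler_pdivrMr ?mul1r//= ltW.
have mS : measurable_fun setT S by apply: measurable_sum.
have mE : measurable [set t | (s <= u * (m%:R^-1 * S t - p))%R].
  rewrite (_ : [set _ | _] = (fun t => u * (m%:R^-1 * S t - p)) @^-1` `[s, +oo[%classic).
    have mf : measurable_fun setT (fun t => u * (m%:R^-1 * S t - p)).
      apply: measurable_funM => //; apply: measurable_funB => //.
      exact: measurable_funM.
    rewrite -[X in measurable X]setTI; exact: mf.
  by apply/seteqP; split => t /=; rewrite in_itv/= andbT.
(* Two numbers in [0, 1] cannot differ by more than 1, so the event is empty when [s > 1]; otherwise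
   [q] below stays within the range of [expR_le_quadratic]. *)
have [s1|s1] := ltP 1 s.
  rewrite (_ : [set _ | _] = set0) ?measure0 ?lee_fin ?expR_ge0//.
  apply/seteqP; split => t //=; have := mean1 t; rewrite -/(S t).
  by case/orP: u1 => /eqP ->; set x := _ * S t; lra.
(* On the event the exponent gains [m s^2 / 4] over [q m p], while the quadratic loss [2 m p q^2] is
   at most [m s^2 / 8]. *)
pose q := u * s / 4.
have q2 : q ^+ 2 = s ^+ 2 / 16.
  by rewrite /q; case/orP: u1 => /eqP ->; field.
have qh : q <= 2^-1 by rewrite /q; case/orP: u1 => /eqP ->; lra.
have Y0 z : 0 <= z <= 1 -> 0 <= 1 + (expR q - 1) * z.
  by move=> z01; apply: le_trans (expR_le_chord q z01); exact: expR_ge0.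
have fY l : factors P (F l) (fun t => 1 + (expR q - 1) * Z l t) (1 + (expR q - 1) * p).
  apply: factors_affine => // [t|]; apply: Y0; first by rewrite Z0 Z1.
  by rewrite p0.
set K := expR (q * (m%:R * p) + m%:R * s ^+ 2 / 4).
have : (K%:E * P [set t | (s <= u * (m%:R^-1 * S t - p))%R] <=
   (expR (m%:R * (p * q + 2 * p * q ^+ 2)))%:E)%E.
  (* Markov's inequality: the constant [K] on the event is below the product of the chords. *)
  apply: (@le_trans _ _ (\int[P]_t (\prod_(l <- iota 0 m) (1 + (expR q - 1) * Z l t))%:E)%E).
    rewrite -[X in P X]setIT -integral_indic// -ge0_integralZl_EFin//; last 2 first.
    - exact/measurable_EFinP/measurable_indic.
    - exact: expR_ge0.
    apply: ge0_le_integral => //.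
    - by move=> t _; rewrite -EFinM lee_fin mulr_ge0// expR_ge0.
    - by apply: measurable_funeM; exact/measurable_EFinP/measurable_indic.
    - by apply/measurable_EFinP; apply: measurable_prod => l _; have [] := fY l.
    - move=> t _; rewrite -EFinM lee_fin indicE.
      have [|_] := boolP (t \in _); last first.
        by rewrite mulr0; apply: prodr_ge0 => l _; rewrite Y0// Z0 Z1.
      rewrite inE/= mulr1 => st.
      apply: (@le_trans _ _ (expR (q * S t))).
        rewrite ler_expR.
        have : s / 4 * (s * m%:R) <= s / 4 * (u * (S t - m%:R * p)).
          apply: ler_wpM2l; first by lra.
          rewrite -ler_pdivlMr//; apply: le_trans st _.
          by rewrite le_eqVlt; apply/orP; left; apply/eqP; field; rewrite gt_eqF.
        by rewrite /q; nra.
      rewrite /S mulr_sumr expR_sum -(big_mkord xpredT (fun l => expR (q * Z l t))).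
      rewrite /index_iota subn0; apply: ler_prod => l _.
      by rewrite expR_ge0 expR_le_chord// Z0 Z1.
  rewrite (@factors_prod _ _ _ _ _ _ (fun l t => 1 + (expR q - 1) * Z l t)
    (fun=> 1 + (expR q - 1) * p) (iota 0 m) indF mF (iota_uniq _ _))//.
  rewrite lee_fin big_const_seq count_predT size_iota iter_mulr_1.
  rewrite expRM_natl lerXn2r ?nnegrE ?expR_ge0 ?Y0 ?p0//.
  apply: le_trans (expR_ge1Dx _) _; rewrite ler_expR.
  have := expR_le_quadratic qh => /(ler_wpM2l p0); nra.
rewrite -lee_pdivlMl ?expR_gt0// -EFinM => /le_trans; apply.
rewrite lee_fin -expRN -expRD ler_expR q2.
have : m%:R * p * s ^+ 2 <= m%:R * s ^+ 2.
  by rewrite -mulrA ler_wpM2l ?ler_piMl ?sqr_ge0// ltW.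
nra.
Qed.
End Tail.

(** * The sampling model *)

Section Clip.
Context (R : realType) (a b : R).

(** Rewards lie in [a, b] only almost surely; truncating puts the rescaled rewards in [0, 1] at
    every outcome. *)
Definition clip (x : R) : R := Num.max 0 (Num.min 1 ((x - a) / (b - a))).

Lemma clip_ge0 x : 0 <= clip x. Proof. by rewrite le_max lexx. Qed.

Lemma clip_le1 x : clip x <= 1.
Proof. by rewrite ge_max ler01 ge_min lexx. Qed.

Lemma clipE x : a < b -> a <= x <= b -> a + (b - a) * clip x = x.
Proof.
move=> ab /andP[ax xb]; have ba : 0 < b - a by rewrite subr_gt0.
rewrite /clip (min_idPr _); last by rewrite ler_pdivrMr// mul1r lerB.
rewrite (max_idPr _); last by rewrite divr_ge0 ?subr_ge0// ltW.
by field; rewrite gt_eqF.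
Qed.

Lemma measurable_clip : measurable_fun [set: measurableTypeR R] clip.
Proof.
apply: measurable_maxr => //; apply: measurable_minr => //.
by apply: measurable_funM => //; exact: measurable_funB.
Qed.

Context (m : probability (measurableTypeR R) R).

Lemma integral_clip : 0 <= a -> a < b -> supported_in a b m ->
  (\int[m]_x (clip x)%:E = (((\int[m]_x x)%R - a) / (b - a))%:E)%E.
Proof.
move=> a0 ab sab; have ba : 0 < b - a by rewrite subr_gt0.
have mc := measurable_clip.
have mEc : measurable_fun [set: measurableTypeR R] (fun x => (clip x)%:E).
  exact/measurable_EFinP.
have fin : (\int[m]_x (clip x)%:E)%E \is a fin_num.
  rewrite ge0_fin_numE; last by apply: integral_ge0 => x _; rewrite lee_fin clip_ge0.
  apply: (@le_lt_trans _ _ (\int[m]_x (cst 1 x))%E); last first.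
    by rewrite integral_cst// mul1e [ltLHS]probability_setT ltry.
  by apply: ge0_le_integral => // x _; rewrite lee_fin ?clip_ge0 ?clip_le1.
have -> : (\int[m]_x x)%R = a + (b - a) * fine (\int[m]_x (clip x)%:E)%E.
  rewrite /Rintegral (_ : \int[m]_x x%:E = \int[m]_x (a + (b - a) * clip x)%:E)%E.
    under eq_integral do rewrite EFinD (EFinM (b - a)).
    rewrite ge0_integralD//; last 2 first.
    - by move=> x _; rewrite -EFinM lee_fin mulr_ge0 ?clip_ge0// ltW.
    - exact: measurable_funeM.
    rewrite ge0_integralZl_EFin//; last 2 first.
    - by move=> x _; rewrite lee_fin clip_ge0.
    - by rewrite ltW.
    rewrite integral_cst// [X in (_ * X)%E]probability_setT mule1.
    by rewrite -(fineK fin) -EFinM -EFinD.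
  (* The two integrands agree on [a, b], whose complement is null. *)
  apply: ae_eq_integral => //.
  - by apply/measurable_EFinP/measurable_funD => //; exact: measurable_funM.
  exists (~` `[a, b]%classic); split.
  - exact: measurableC.
  - by rewrite [LHS]probability_setC// [X in (_ - X)%E]sab subee.
  - by move=> x /= Hx xab; apply: Hx => _; rewrite clipE.
rewrite -[LHS](fineK fin); congr EFin; field.
by rewrite gt_eqF.
Qed.

Lemma mean_supported : 0 <= a -> a < b -> supported_in a b m ->
  a <= (\int[m]_x x)%R <= b.
Proof.
move=> a0 ab sab; have ba : 0 < b - a by rewrite subr_gt0.
have mEc : measurable_fun [set: measurableTypeR R] (fun x => (clip x)%:E).
  by apply/measurable_EFinP; exact: measurable_clip.
have := integral_clip a0 ab sab; set p := _ / _ => pE.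
have p0 : 0 <= p.
  by rewrite -lee_fin -pE; apply: integral_ge0 => x _; rewrite lee_fin clip_ge0.
have p1 : p <= 1.
  rewrite -lee_fin -pE; apply: (@le_trans _ _ (\int[m]_x (cst 1 x))%E).
    by apply: ge0_le_integral => // x _; rewrite lee_fin ?clip_ge0 ?clip_le1.
  by rewrite integral_cst// mul1e [leLHS]probability_setT.
have -> : (\int[m]_x x)%R = a + p * (b - a) by rewrite /p; field; rewrite gt_eqF.
nra.
Qed.
End Clip.

Section Model.
Context (R : realType) (n : nat) (nu : 'I_n -> probability (measurableTypeR R) R).
Context (d : measure_display) (T : measurableType d) (P : probability T R).
Context (arm : nat -> T -> 'I_n) (x1 x2 : nat -> {RV P >-> R}).
Context (y : 'I_n -> nat -> {RV P >-> R}).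
Hypothesis model : sampling_model nu arm x1 x2 y.

Let F := sample_events arm x1 x2 y.

Lemma measurable_rv_preimage (X : {RV P >-> R}) (A : set (measurableTypeR R)) :
  measurable A -> measurable (X @^-1` A).
Proof. by move=> mA; rewrite -[X in measurable X]setTI; exact: measurable_funP. Qed.

Lemma measurable_arm l (D : set 'I_n) : measurable (arm l @^-1` D).
Proof.
rewrite (_ : _ @^-1` D = \bigcup_(i in D) (arm l @^-1` [set i])).
  apply: fin_bigcup_measurable => [|i _]; first exact: finite_finset.
  exact: arm_measurable model l i.
apply/seteqP; split => [t Dt|t [i Di /= ti]]; first by exists (arm l t).
by rewrite /= ti.
Qed.

Lemma measurable_sample_events j : F j `<=` measurable.
Proof.
case: j => [l|[i l]] E /=.
  move=> [D [A [B [mA mB ->]]]]; apply: measurableI; first exact: measurable_arm.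
  by apply: measurableI; exact: measurable_rv_preimage.
by move=> [A mA ->]; exact: measurable_rv_preimage.
Qed.

Lemma sample_eventsT j : F j setT.
Proof.
case: j => [l|[i l]] /=.
  by exists setT, setT, setT; split => //; rewrite !preimage_setT !setTI.
by exists setT => //; rewrite preimage_setT.
Qed.

Lemma factors_sequential i l (f : R -> R) (e : R) :
  measurable_fun [set: measurableTypeR R] f -> (forall x, 0 <= f x) ->
  (\int[nu i]_x (f x)%:E = e%:E)%E ->
  factors P (F (inr (i, l))) (fun t => f (y i l t)) e.
Proof.
move=> mf f0 fe; split => //.
- exact: measurableT_comp.
- by rewrite -lee_fin -fe; apply: integral_ge0 => x _; rewrite lee_fin.
- move=> W c mW W0 c0 HW.
  rewrite (integral_factor_comp (m := nu i) (c := c))// ?fe//.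
    exact: (@measurable_funP _ _ _ _ setT (y i l)).
  move=> A mA; transitivity (c%:E * P (y i l @^-1` A))%E.
    by apply: (HW (y i l @^-1` A)); exists A.
  by congr (_ * _)%E; exact: (sequential_law model).
Qed.

(** On the event that arm [i] is chosen, [step1] replaces [f (x1 l)] by its mean while testing
    [x2 l] only on sets, and [step2] then integrates [g (x2 l)]. Summing over the uniform arm gives
    the mean of the products. *)
Lemma factors_random l (f g : R -> R) (ef eg : 'I_n -> R) :
  measurable_fun [set: measurableTypeR R] f -> (forall x, 0 <= f x) ->
  measurable_fun [set: measurableTypeR R] g -> (forall x, 0 <= g x) ->
  (forall i, (\int[nu i]_x (f x)%:E = (ef i)%:E)%E) ->
  (forall i, (\int[nu i]_x (g x)%:E = (eg i)%:E)%E) ->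
  factors P (F (inl l)) (fun t => f (x1 l t) * g (x2 l t))
    (n%:R^-1 * \sum_(i < n) ef i * eg i).
Proof.
move=> mf f0 mg g0 fe ge.
have mfx : measurable_fun setT (fun t => f (x1 l t)) by exact: measurableT_comp.
have mgx : measurable_fun setT (fun t => g (x2 l t)) by exact: measurableT_comp.
have ef0 i : 0 <= ef i.
  by rewrite -lee_fin -fe; apply: integral_ge0 => x _; rewrite lee_fin.
have eg0 i : 0 <= eg i.
  by rewrite -lee_fin -ge; apply: integral_ge0 => x _; rewrite lee_fin.
split.
- exact: measurable_funM.
- by move=> t; rewrite mulr_ge0.
- by rewrite mulr_ge0// ?invr_ge0// sumr_ge0// => i _; rewrite mulr_ge0.
move=> W c mW W0 c0 HW.
pose I i : T -> R := \1_(arm l @^-1` [set i]).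
have mI i : measurable_fun setT (I i).
  by apply: measurable_indic; exact: measurable_arm.
have I0 i t : 0 <= I i t by rewrite /I indicE.
have cn0 : 0 <= c / n%:R by rewrite divr_ge0.
have step1 i (B : set (measurableTypeR R)) : measurable B ->
    (\int[P]_t (W t * I i t * f (x1 l t) * \1_B (x2 l t))%:E
     = (c / n%:R * ef i)%:E * nu i B)%E.
  move=> mB; have mB2 : measurable_fun setT (fun t => \1_B (x2 l t) : R).
    exact: measurableT_comp.
  have nuB : nu i B = (fine (nu i B))%:E by rewrite fineK// fin_num_measure.
  under eq_integral do rewrite -mulrA (mulrC (f _)) mulrA.
  rewrite (integral_factor_comp (m := nu i) (X := x1 l) (c := c / n%:R * fine (nu i B)))//.
  - by rewrite fe nuB /= -!EFinM; congr EFin; ring.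
  - by apply: measurable_funM => //; exact: measurable_funM.
  - by move=> t; rewrite !mulr_ge0.
  - exact: (@measurable_funP _ _ _ _ setT (x1 l)).
  - by rewrite mulr_ge0// fine_ge0.
  - move=> A mA.
    set E := arm l @^-1` [set i] `&` (x1 l @^-1` A `&` x2 l @^-1` B).
    transitivity (\int[P]_t (W t * \1_E t)%:E)%E.
      apply: eq_integral => t _; rewrite /E !indicI/=; congr EFin.
      by rewrite /I !indicE; ring.
    rewrite HW; last by exists [set i], A, B.
    rewrite (random_sample_law model l i mA mB).
    rewrite !EFinM -!muleA; congr (_ * (_ * _))%E; rewrite muleC; congr (_ * _)%E.
    exact: nuB.
have step2 i : (\int[P]_t (W t * I i t * f (x1 l t) * g (x2 l t))%:E
     = (c / n%:R * ef i * eg i)%:E)%E.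
  rewrite (integral_factor_comp (m := nu i) (X := x2 l) (c := c / n%:R * ef i))//.
  - by rewrite ge -EFinM.
  - by do 2 apply: measurable_funM => //.
  - by move=> t; rewrite !mulr_ge0.
  - exact: (@measurable_funP _ _ _ _ setT (x2 l)).
  - by rewrite mulr_ge0.
  - exact: step1.
have -> : c * (n%:R^-1 * \sum_(i < n) ef i * eg i) = \sum_(i < n) c / n%:R * ef i * eg i.
  by rewrite mulrA mulr_sumr; apply: eq_bigr => i _; rewrite mulrA.
rewrite -sumEFin; under eq_bigr do rewrite -step2.
rewrite -ge0_integral_sum//; last 2 first.
- move=> i; apply/measurable_EFinP; apply: measurable_funM => //.
  by do 2 apply: measurable_funM => //.
- by move=> i t _; rewrite lee_fin !mulr_ge0.
apply: eq_integral => t _; rewrite sumEFin; congr EFin.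
(* At each outcome exactly one arm is chosen, so only one indicator survives. *)
rewrite (bigD1 (arm l t))//= big1 ?addr0; last first.
  move=> i it; rewrite /I indicE memNset ?mulr0 ?mul0r//=.
  by move/eqP; rewrite eq_sym (negbTE it).
by rewrite /I indicE mem_set// mulr1 mulrA.
Qed.
End Model.

Section Moments.
Context (R : realType).
Implicit Types (a c : R) (m : nat).

Lemma mean_affine m a c (z : nat -> R) : (0 < m)%N ->
  m%:R^-1 * \sum_(l < m) (a + c * z l) = a + c * (m%:R^-1 * \sum_(l < m) z l).
Proof.
move=> m0; rewrite big_split/= sumr_const card_ord -mulr_sumr -mulr_natl.
by field; rewrite pnatr_eq0 -lt0n.
Qed.

Lemma cov_affine m a c (z1 z2 : nat -> R) : (0 < m)%N ->
  m%:R^-1 * (\sum_(l < m) (a + c * z1 l) * (a + c * z2 l))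
  - (m%:R ^+ 2)^-1 * \sum_(l < m) \sum_(h < m) (a + c * z1 l) * (a + c * z2 h)
  = c ^+ 2 * (m%:R^-1 * (\sum_(l < m) z1 l * z2 l)
     - (m%:R^-1 * \sum_(l < m) z1 l) * (m%:R^-1 * \sum_(l < m) z2 l)).
Proof.
move=> m0.
under [X in _ - _ * X]eq_bigr do rewrite -mulr_sumr.
rewrite -mulr_suml.
have E z : \sum_(l < m) (a + c * z l) = m%:R * a + c * \sum_(l < m) z l.
  by rewrite big_split/= sumr_const card_ord -mulr_sumr mulr_natl.
have -> : \sum_(l < m) (a + c * z1 l) * (a + c * z2 l) =
    m%:R * a ^+ 2 + a * c * (\sum_(l < m) z1 l + \sum_(l < m) z2 l)
    + c ^+ 2 * \sum_(l < m) z1 l * z2 l.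
  rewrite [LHS](eq_bigr (fun l : 'I_m =>
    a ^+ 2 + a * c * (z1 l + z2 l) + c ^+ 2 * (z1 l * z2 l))); last first.
    by move=> l _; ring.
  by rewrite !big_split/= sumr_const card_ord -!mulr_sumr big_split/= mulr_natl.
by rewrite !E; field; rewrite pnatr_eq0 -lt0n.
Qed.

(** Mean of squares minus square of the mean: the two parts are expressed by the expectations of the
    product and of one coordinate of a random sample, which the concentration event controls. *)
Lemma sigma_armsE n a c (p : 'I_n -> R) : (0 < n)%N ->
  sigma_arms (fun i => a + c * p i) ^+ 2 =
  c ^+ 2 * (n%:R^-1 * (\sum_(i < n) p i * p i) - (n%:R^-1 * \sum_(i < n) p i) ^+ 2).
Proof.
move=> n0; have nN0 : n%:R != 0 :> R by rewrite pnatr_eq0 -lt0n.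
rewrite sqr_sqrtr; last first.
  by rewrite mulr_ge0 ?invr_ge0// sumr_ge0// => i _; exact: sqr_ge0.
rewrite /mu_arms big_split/= sumr_const card_ord -mulr_sumr -[a *+ n]mulr_natl.
set S := \sum_(i < n) p i.
have -> : \sum_(i < n) (a + c * p i - n%:R^-1 * (n%:R * a + c * S)) ^+ 2
    = c ^+ 2 * \sum_(i < n) p i * p i - 2 * c ^+ 2 / n%:R * S * S
      + n%:R * (c / n%:R * S) ^+ 2.
  rewrite [LHS](eq_bigr (fun i : 'I_n => c ^+ 2 * (p i * p i)
    + (- (2 * c ^+ 2 / n%:R * S)) * p i + (c / n%:R * S) ^+ 2)); last first.
    by move=> i _; field.
  rewrite !big_split/= sumr_const card_ord -!mulr_sumr -/S.
  by rewrite mulNr [n%:R * _]mulr_natl.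
by field.
Qed.

(** The error splits into [z12 - q2], [z1 * (z2 - q)] and [q * (z1 - q)], each at most [e] in
    absolute value. *)
Lemma variance_deviation (z1 z2 z12 q q2 e : R) : `|z1| <= 1 -> `|q| <= 1 ->
  `|z1 - q| <= e -> `|z2 - q| <= e -> `|z12 - q2| <= e ->
  `|z12 - z1 * z2 - (q2 - q ^+ 2)| <= 3 * e.
Proof.
move=> z1_le1 q_le1 H1 H2 H12.
have -> : z12 - z1 * z2 - (q2 - q ^+ 2) =
  (z12 - q2) - (z1 * (z2 - q) + q * (z1 - q)) by ring.
apply: le_trans (ler_normB _ _) _.
have A : `|z1 * (z2 - q)| <= e.
  by rewrite normrM -[leRHS]mul1r ler_pM.
have B : `|q * (z1 - q)| <= e by rewrite normrM -[leRHS]mul1r ler_pM.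
have := ler_normD (z1 * (z2 - q)) (q * (z1 - q)); lra.
Qed.
End Moments.

Section Confidence.
Context (R : realType) (n : nat) (delta : R).
Hypothesis delta01 : 0 < delta < 1.

Lemma inv_delta_at t : (0 < t)%N ->
  1 / delta_at n delta t = (n%:R + 4) * pi ^+ 2 * t%:R ^+ 2 / (3 * delta).
Proof.
move=> t0; rewrite /delta_at; have := pi_gt0 R; move: (pi : R) => p p0.
have n4 : 0 < n%:R + 4 :> R by rewrite ltr_wpDl.
have /andP[d0 _] := delta01.
by field; rewrite !gt_eqF// ltr0n.
Qed.

Lemma delta_at_gt0 t : (0 < t)%N -> 0 < delta_at n delta t.
Proof.
move=> t0; have /andP[d0 d1] := delta01.
by rewrite /delta_at divr_gt0 ?mulr_gt0 ?exprn_gt0 ?pi_gt0 ?ltr0n // ltr_wpDl.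
Qed.

Lemma delta_at_le t : (0 < t)%N ->
  delta_at n delta t <= 3 * delta / (4 * (n%:R + 4) * t%:R ^+ 2).
Proof.
move=> t0; have /andP[d0 d1] := delta01.
have t2 : 0 < t%:R ^+ 2 :> R by rewrite exprn_gt0 ?ltr0n.
have n4 : 0 < n%:R + 4 :> R by rewrite ltr_wpDl.
rewrite /delta_at ler_pM2l ?mulr_gt0// lef_pV2 ?posrE ?mulr_gt0 ?exprn_gt0 ?pi_gt0 ?ltr0n//.
rewrite ler_pM2r// mulrC ler_pM2l//.
have := pi_ge2 R; nra.
Qed.

Lemma ln_inv_delta_at_gt0 t : (0 < t)%N -> 0 < ln (1 / delta_at n delta t).
Proof.
move=> t0; apply: ln_gt0; rewrite div1r invf_gt1 ?delta_at_gt0//.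
apply: le_lt_trans (delta_at_le t0) _; have /andP[d0 d1] := delta01.
have t2 : 1 <= t%:R ^+ 2 :> R by rewrite exprn_ege1// ler1n.
have n4 : 4 <= n%:R + 4 :> R by rewrite lerDr.
rewrite ltr_pdivrMr ?mul1r; nra.
Qed.
End Confidence.

Section Accuracy.
Context (R : realType) (n : nat) (n_gt0 : (0 < n)%N) (a b delta : R).

(* Comparing with [confidence m m], which is at most [confidence t m] in every
   round [t >= m], makes the estimate uniform in the number of samples, so that it
   applies to the data-dependent counts of the algorithm. *)
Definition accurate (x1 x2 : nat -> R) (y : 'I_n -> nat -> R) (ym : 'I_n -> R) : Prop :=
  forall m, (0 < m)%N ->
  [/\ forall i, `|y_hat y i m - ym i| <= 6 * ((b - a) * confidence n delta m m),
      `|mu_hat x1 m - mu_arms ym| <= 6 * ((b - a) * confidence n delta m m) &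
      `|sigma_hat x1 x2 m ^+ 2 - sigma_arms ym ^+ 2|
        <= 6 * eps_sigma n a b delta m m].

Lemma mean_itv (m : nat) (z : 'I_m -> R) : (forall l, 0 <= z l <= 1) ->
  0 <= m%:R^-1 * \sum_(l < m) z l <= 1.
Proof.
move=> z01; rewrite mulr_ge0 ?invr_ge0//=; last first.
  by apply: sumr_ge0 => l _; case/andP: (z01 l).
case: m z z01 => [|m] z z01; first by rewrite big_ord0 mulr0.
rewrite mulrC ler_pdivrMr ?ltr0n// mul1r.
rewrite -[leRHS]mulr1 mulr_natl -[in leRHS](card_ord m.+1) -sumr_const.
by apply: ler_sum => l _; case/andP: (z01 l).
Qed.

Lemma accurate_affine (z1 z2 : nat -> R) (zy : 'I_n -> nat -> R) (p : 'I_n -> R) :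
  0 <= a -> a < b -> (forall l, 0 <= z1 l <= 1) -> (forall i, 0 <= p i <= 1) ->
  (forall m, (0 < m)%N -> let e := 6 * confidence n delta m m in
    [/\ forall i, `|m%:R^-1 * \sum_(l < m) zy i l - p i| <= e,
        `|m%:R^-1 * \sum_(l < m) z1 l - n%:R^-1 * \sum_(i < n) p i| <= e,
        `|m%:R^-1 * \sum_(l < m) z2 l - n%:R^-1 * \sum_(i < n) p i| <= e &
        `|m%:R^-1 * \sum_(l < m) z1 l * z2 l - n%:R^-1 * \sum_(i < n) p i * p i| <= e]) ->
  accurate (fun l => a + (b - a) * z1 l) (fun l => a + (b - a) * z2 l)
    (fun i l => a + (b - a) * zy i l) (fun i => a + (b - a) * p i).
Proof.
move=> a0 ab z01 p01 H m m0; have [Hy H1 H2 H12] := H m m0.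
have ba : 0 < b - a by rewrite subr_gt0.
have nR0 : n%:R != 0 :> R by rewrite pnatr_eq0 -lt0n.
have scale u v : `|u - v| <= 6 * confidence n delta m m ->
    `|a + (b - a) * u - (a + (b - a) * v)| <= 6 * ((b - a) * confidence n delta m m).
  move=> uv; rewrite (_ : _ - _ = (b - a) * (u - v)); last by ring.
  by rewrite normrM gtr0_norm// mulrCA ler_pM2l.
split.
- by move=> i; rewrite /y_hat mean_affine//; exact: scale.
- rewrite /mu_hat mean_affine// /mu_arms (_ : n%:R^-1 * _ = a + (b - a) *
    (n%:R^-1 * \sum_(i < n) p i)); first exact: scale.
  rewrite big_split/= sumr_const card_ord -mulr_sumr -[a *+ n]mulr_natl.
  by field.
have s0 : 0 <= sigma_arms (fun i => a + (b - a) * p i) ^+ 2 by exact: sqr_ge0.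
rewrite /sigma_hat sqr_sqrtr// cov_affine//.
(* The absolute value inside [sigma_hat] only helps, because the variance it estimates is
   nonnegative. *)
rewrite -[X in `|_ - X|](ger0_norm s0); apply: le_trans (ler_dist_dist _ _) _.
rewrite sigma_armsE// -mulrBr normrM ger0_norm ?sqr_ge0//.
have V : `|m%:R^-1 * (\sum_(l < m) z1 l * z2 l) - m%:R^-1 * (\sum_(l < m) z1 l) *
    (m%:R^-1 * \sum_(l < m) z2 l) - (n%:R^-1 * (\sum_(i < n) p i * p i)
    - (n%:R^-1 * \sum_(i < n) p i) ^+ 2)| <= 3 * (6 * confidence n delta m m).
  apply: variance_deviation => //.
  - have /andP[? ?] := mean_itv (fun l : 'I_m => z01 l).
    by rewrite ger0_norm.
  - have /andP[? ?] := mean_itv p01.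
    by rewrite ger0_norm.
apply: le_trans (ler_wpM2l (sqr_ge0 _) V) _.
rewrite /eps_sigma /range1 /range2.
have c0 : 0 <= confidence n delta m m by exact: sqrtr_ge0.
have -> : (b - a) ^+ 2 * (3 * (6 * confidence n delta m m)) =
  6 * (3 * (b - a) ^+ 2 * confidence n delta m m) by ring.
rewrite ler_pM2l// ler_wpM2r//.
(* The factor 3 of [variance_deviation] is absorbed by the range: [3 (b - a) <= a + 3 b] because
   [a >= 0]. *)
have -> : b ^+ 2 - a ^+ 2 + 2 * b * (b - a) = (b - a) * (a + 3 * b) by ring.
have -> : 3 * (b - a) ^+ 2 = (b - a) * (3 * (b - a)) by ring.
by rewrite ler_pM2l//; lra.
Qed.
End Accuracy.

(** * The concentration event and its probability *)

Section Series.
Context (R : realType).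

(** The bounds telescope: the sum of the first [N] terms is at most [e - e / (N + 1)]. *)
Lemma nneseries_telescope_le (e : R) (f : nat -> \bar R) : 0 <= e ->
  (forall k, 0 <= f k)%E ->
  (forall k, f k <= (e / (k.+1%:R * k.+2%:R))%:E)%E ->
  (\sum_(k <oo) f k <= e%:E)%E.
Proof.
move=> e0 f0 fe; apply: lime_le; first exact: is_cvg_nneseries.
apply: nearW => N.
apply: (@le_trans _ _ (e - e / N.+1%:R)%:E).
  elim: N => [|N IH]; first by rewrite big_geq// divr1 subrr.
  rewrite big_nat_recr//=; apply: le_trans (leeD IH (fe N)) _.
  rewrite -EFinD lee_fin le_eqVlt; apply/orP; left; apply/eqP.
  have N1 : 0 < N.+1%:R :> R by [].
  rewrite -[N.+2%:R]natr1; move: N1; set x := N.+1%:R => x0.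
  by field; rewrite !gt_eqF//; lra.
by rewrite lee_fin gerBl divr_ge0.
Qed.
End Series.

Section Measure.
Context (R : realType) (d : measure_display) (T : measurableType d).
Context (P : probability T R).

Lemma integral_probability1 : (\int[P]_x (cst 1 x : R)%:E = 1%:E)%E.
Proof.
transitivity (\int[P]_x (cst 1%E x))%E => //.
by rewrite integral_cst// mul1e [LHS]probability_setT.
Qed.

Lemma probability_bigsetU_le (I : Type) (s : seq I) (E : I -> set T) :
  (forall i, measurable (E i)) ->
  (P (\big[setU/set0]_(i <- s) E i) <= \sum_(i <- s) P (E i))%E.
Proof.
move=> mE; elim: s => [|i s IH]; first by rewrite !big_nil measure0.
rewrite !big_cons; apply: le_trans (measureU2 _ _ _) (leeD _ IH) => //.
exact: bigsetU_measurable.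
Qed.
End Measure.

Section GoodEvent.
Context (R : realType) (n : nat) (n_gt0 : (0 < n)%N) (a b delta : R).
Context (nu : 'I_n -> probability (measurableTypeR R) R).
Hypotheses (a_ge0 : 0 <= a) (ab : a < b) (delta01 : 0 < delta < 1).
Hypothesis nu_ab : forall i, supported_in a b (nu i).
Context (d : measure_display) (T : measurableType d) (P : probability T R).
Context (arm : nat -> T -> 'I_n) (x1 x2 : nat -> {RV P >-> R}).
Context (y : 'I_n -> nat -> {RV P >-> R}).
Hypothesis model : sampling_model nu arm x1 x2 y.

Local Notation clip := (clip a b).
Let F := sample_events arm x1 x2 y.
Let p i := (arm_mean nu i - a) / (b - a).

(* [inr None] and [inr (Some false)] are the two coordinates of the random samples,
   [inr (Some true)] is their product. *)
Let stream := ('I_n + option bool)%type.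

Let source (j : stream) (l : nat) : nat + 'I_n * nat :=
  match j with inl i => inr (i, l) | inr _ => inl l end.

Let value (j : stream) (l : nat) (t : T) : R :=
  match j with
  | inl i => clip (y i l t)
  | inr None => clip (x1 l t)
  | inr (Some false) => clip (x2 l t)
  | inr (Some true) => clip (x1 l t) * clip (x2 l t)
  end.

Let mean (j : stream) : R :=
  match j with
  | inl i => p i
  | inr (Some true) => n%:R^-1 * \sum_(i < n) p i * p i
  | inr _ => n%:R^-1 * \sum_(i < n) p i
  end.

Let factors_value j l : factors P (F (source j l)) (value j l) (mean j).
Proof.
have mc := measurable_clip a b.
have c0 := clip_ge0 a b.
have cp i : (\int[nu i]_x (clip x)%:E = (p i)%:E)%E by exact: integral_clip.
have m1 : measurable_fun [set: measurableTypeR R] (cst 1 : R -> R) by [].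
have p1 i : (\int[nu i]_x (cst 1 x : R)%:E = 1%:E)%E.
  exact: integral_probability1.
case: j => [i|[[]|]]; rewrite /mean.
- exact: (factors_sequential model).
- exact: (factors_random model).
(* A single coordinate is a product whose other factor is the constant 1. *)
- rewrite (_ : \sum_(i < n) p i = \sum_(i < n) 1 * p i); last first.
    by apply: eq_bigr => i _; rewrite mul1r.
  rewrite (_ : value _ l = fun t => cst 1 (x1 l t) * clip (x2 l t)); last first.
    by apply/funext => t; rewrite /= mul1r.
  exact: (factors_random model l m1 (fun=> ler01) mc c0 p1 cp).
- rewrite (_ : \sum_(i < n) p i = \sum_(i < n) p i * 1); last first.
    by apply: eq_bigr => i _; rewrite mulr1.
  rewrite (_ : value _ l = fun t => clip (x1 l t) * cst 1 (x2 l t)); last first.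
    by apply/funext => t; rewrite /= mulr1.
  exact: (factors_random model l mc c0 m1 (fun=> ler01) cp p1).
Qed.

Let value_le1 j l t : value j l t <= 1.
Proof.
have c1 := clip_le1 a b; have c0 := clip_ge0 a b.
by case: j => [i|[[]|]] //=; rewrite -[leRHS]mul1r ler_pM.
Qed.

Let dev m : R := 6 * confidence n delta m m.

Let tail (ju : stream * bool) (m : nat) : set T :=
  [set t | dev m <= (-1) ^+ ju.2 * (m%:R^-1 * \sum_(l < m) value ju.1 l t - mean ju.1)].

(** The exponent [m (dev m)^2 / 8] is 9/4 times [ln (1 / delta_at m)], more than the factor 2 that
    the square requires. *)
Let tail_le ju m : (0 < m)%N -> (P (tail ju m) <= (delta_at n delta m ^+ 2)%:E)%E.
Proof.
case: ju => j u m0.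
have L0 := ln_inv_delta_at_gt0 n delta01 m0.
have d0 := delta_at_gt0 n delta01 m0.
pose r (k : nat + 'I_n * nat) := match k with inl l => l | inr (_, l) => l end.
have sK : cancel (source j) r by case: j.
have indF := mutually_independent_comp sK (samples_independent model).
have u1 : ((-1) ^+ u == 1 :> R) || ((-1) ^+ u == -1 :> R).
  by case: u; rewrite ?expr1 ?expr0 eqxx ?orbT.
have := mean_tail indF (fun l => measurable_sample_events model (j := _))
  (fun l => sample_eventsT arm x1 x2 y _) (factors_value j) (value_le1 j) u1 m0
  (s := dev m).
rewrite /dev mulr_ge0 ?sqrtr_ge0// => /(_ isT) H.
apply: le_trans H _; rewrite lee_fin -[leRHS]lnK ?posrE ?exprn_gt0// ler_expR.
rewrite exprMn sqr_sqrtr; last by rewrite divr_ge0 ?ltW// mulr_gt0 ?ltr0n.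
rewrite lnXn//.
have -> : ln (delta_at n delta m) = - ln (1 / delta_at n delta m).
  by rewrite div1r lnV ?posrE// opprK.
set L := ln _ in L0 *.
have -> : m%:R * (6 ^+ 2 * (L / (2 * m%:R))) / 8 = L * (9 / 4).
  by field; rewrite pnatr_eq0 -lt0n.
by rewrite mulNrn lerN2 mulr2n; lra.
Qed.

Let measurable_tail ju m : measurable (tail ju m).
Proof.
have mf : measurable_fun setT (fun t => (-1) ^+ ju.2 *
    (m%:R^-1 * \sum_(l < m) value ju.1 l t - mean ju.1)).
  apply: measurable_funM => //; apply: measurable_funB => //.
  apply: measurable_funM => //; apply: measurable_sum => l.
  by have [] := factors_value ju.1 l.
rewrite (_ : tail _ _ = (fun t => (-1) ^+ ju.2 *
    (m%:R^-1 * \sum_(l < m) value ju.1 l t - mean ju.1)) @^-1` `[dev m, +oo[%classic).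
  by rewrite -[X in measurable X]setTI; exact: mf.
by apply/seteqP; split => t /=; rewrite in_itv/= andbT.
Qed.

Let I := `[a, b]%classic : set (measurableTypeR R).

(** Discarding this null event makes [clip] invertible on the observed samples, so that the rewards
    can be recovered from the clipped streams. *)
Let outside (l : nat) : set T :=
  (x1 l @^-1` (~` I) `|` x2 l @^-1` (~` I)) `|`
  \big[setU/set0]_(i < n) (y i l @^-1` (~` I)).

Let mI : measurable (~` I). Proof. by rewrite /I; exact: measurableC. Qed.

Let nuI i : nu i (~` I) = 0%E.
Proof.
have sab : nu i I = 1%E := nu_ab i.
have mI' : measurable I by rewrite /I.
by rewrite [LHS]probability_setC// [X in (_ - X)%E]sab subee.
Qed.

Let measurable_outside l : measurable (outside l).
Proof.
apply: measurableU; last first.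
  by apply: bigsetU_measurable => i _; exact: measurable_rv_preimage.
by apply: measurableU; exact: measurable_rv_preimage.
Qed.

Let outside0 l : P (outside l) = 0%E.
Proof.
have mind : measurable_fun [set: measurableTypeR R] (\1_(~` I) : R -> R) by [].
have i0 x : 0 <= \1_(~` I) x :> R by rewrite indicE.
have e0 i : (\int[nu i]_x (\1_(~` I) x)%:E = 0%:E)%E.
  by rewrite integral_indic// setIT; exact: nuI.
have m1 : measurable_fun [set: measurableTypeR R] (cst 1 : R -> R) by [].
have p1 i : (\int[nu i]_x (cst 1 x : R)%:E = 1%:E)%E.
  exact: integral_probability1.
have mF := measurable_sample_events model (j := inl l).
have N1 : P (x1 l @^-1` (~` I)) = 0%E.
  have := factors_integral mF (factors_random model l mind i0 m1 (fun=> ler01) e0 p1).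
  rewrite big1 ?mulr0 => [E0|i _]; last by rewrite mul0r.
  apply: etrans E0.
  rewrite -[in LHS](setIT (_ @^-1` _)) -integral_indic//; last exact: measurable_rv_preimage.
  by apply: eq_integral => t _; rewrite mulr1.
have N2 : P (x2 l @^-1` (~` I)) = 0%E.
  have := factors_integral mF (factors_random model l m1 (fun=> ler01) mind i0 p1 e0).
  rewrite big1 ?mulr0 => [E0|//].
  apply: etrans E0.
  rewrite -[in LHS](setIT (_ @^-1` _)) -integral_indic//; last exact: measurable_rv_preimage.
  by apply: eq_integral => t _; rewrite mul1r.
have N3 i : P (y i l @^-1` (~` I)) = 0%E by rewrite [LHS](sequential_law model i l mI); exact: nuI.
apply/eqP; rewrite eq_le measure_ge0 andbT.
apply: le_trans (measureU2 _ _ _) _.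
- by apply: measurableU; exact: measurable_rv_preimage.
- by apply: bigsetU_measurable => i _; exact: measurable_rv_preimage.
rewrite -[leRHS]adde0; apply: leeD.
  rewrite -[leRHS]adde0; apply: le_trans (measureU2 _ _ _) _;
    do ?exact: measurable_rv_preimage.
  by apply: leeD; rewrite le_eqVlt; apply/orP; left; apply/eqP; [exact: N1|exact: N2].
apply: le_trans (probability_bigsetU_le _ _ _) _.
  by move=> i; exact: measurable_rv_preimage.
by rewrite big1// => i _; exact: N3.
Qed.
Let bad (k : nat) : set T :=
  \big[setU/set0]_(ju : stream * bool) tail ju k.+1 `|` outside k.

Let measurable_bad k : measurable (bad k).
Proof. by apply: measurableU => //; exact: bigsetU_measurable. Qed.

(** There are [n + 3] streams and two signs, hence [2 (n + 3)] tail events at sample count [k + 1].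
    Bounding [delta_at] by [delta_at_le] leaves [delta] times [delta <= 1], a factor at most 1/2
    depending on [n], and one at most 2 depending on the count. *)
Let bad_le k : (P (bad k) <= (delta / (k.+1%:R * k.+2%:R))%:E)%E.
Proof.
have /andP[d0 d1] := delta01.
apply: (@le_trans _ _ (2 * (n%:R + 3) * delta_at n delta k.+1 ^+ 2)%:E).
  apply: le_trans (measureU2 _ _ _) _ => //; first exact: bigsetU_measurable.
  rewrite -[leRHS]adde0; apply: leeD; last first.
    by rewrite le_eqVlt; apply/orP; left; apply/eqP; exact: outside0.
  apply: le_trans (probability_bigsetU_le _ _ _) _ => //.
  apply: (@le_trans _ _ (\sum_(ju : stream * bool) (delta_at n delta k.+1 ^+ 2)%:E)%E).
    by apply: lee_sum => ju _; exact: tail_le.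
  rewrite sumEFin sumr_const card_prod card_sum card_ord card_option card_bool.
  rewrite lee_fin -[X in X <= _]mulr_natl natrM natrD -natr1 le_eqVlt; apply/orP; left.
  by apply/eqP; ring.
rewrite lee_fin.
have D := delta_at_le n delta01 (ltn0Sn k).
have D0 := ltW (delta_at_gt0 n delta01 (ltn0Sn k)).
set m : R := k.+1%:R in D *.
have m1 : 1 <= m by rewrite ler1n.
have m0 : 0 < m by lra.
rewrite -[k.+2%:R]natr1 -/m.
have n0 : 0 <= n%:R :> R by [].
set N : R := n%:R in n0 D *.
have D2 : delta_at n delta k.+1 ^+ 2 <= (3 * delta / (4 * (N + 4) * m ^+ 2)) ^+ 2.
  by rewrite lerXn2r// nnegrE// (le_trans D0).
apply: (@le_trans _ _ (2 * (N + 3) * (3 * delta / (4 * (N + 4) * m ^+ 2)) ^+ 2)).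
  by rewrite ler_pM2l// mulr_gt0//; lra.
rewrite ler_pdivlMr ?mulr_gt0//; try lra.
have -> : 2 * (N + 3) * (3 * delta / (4 * (N + 4) * m ^+ 2)) ^+ 2 * (m * (m + 1))
  = delta * (delta * ((9 * (N + 3)) / (8 * (N + 4) ^+ 2)) * ((m + 1) / m ^+ 3)).
  by field; rewrite !gt_eqF//; lra.
rewrite ler_piMr//; first exact: ltW.
have A : (9 * (N + 3)) / (8 * (N + 4) ^+ 2) <= 1 / 2.
  by rewrite ler_pdivrMr ?mulr_gt0 ?exprn_gt0//; nra.
have A0 : 0 <= (9 * (N + 3)) / (8 * (N + 4) ^+ 2).
  by rewrite divr_ge0 ?mulr_ge0 ?exprn_ge0//; lra.
have B : (m + 1) / m ^+ 3 <= 2.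
  rewrite ler_pdivrMr ?exprn_gt0//.
  have := exprn_ege1 2 m1; have : m <= m ^+ 3 by rewrite ler_eXnr.
  lra.
have B0 : 0 <= (m + 1) / m ^+ 3 by rewrite divr_ge0 ?exprn_ge0//; lra.
rewrite [leRHS](_ : 1 = 1 * (1 / 2) * 2); last by field.
by apply: ler_pM => //; [rewrite mulr_ge0// ltW|rewrite ler_pM// ltW].
Qed.

Let good : set T := ~` \bigcup_k bad k.

Let good_mean t j m : good t -> (0 < m)%N ->
  `|m%:R^-1 * \sum_(l < m) value j l t - mean j| <= dev m.
Proof.
move=> gt m0; rewrite leNgt; apply/negP => H; apply: gt.
exists m.-1 => //; left; rewrite prednK//.
set v := _ - _ in H.
have [v0|v0] := leP 0 v.
  rewrite -bigcup_seq_cond; exists (j, false); rewrite /= ?mem_index_enum//.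
  by rewrite /tail/= expr0 mul1r -/v ltW// -(ger0_norm v0).
rewrite -bigcup_seq_cond; exists (j, true); rewrite /= ?mem_index_enum//.
by rewrite /tail/= expr1 mulN1r -/v ltW// -(ltr0_norm v0).
Qed.

Let good_inside t l : good t ->
  [/\ a <= x1 l t <= b, a <= x2 l t <= b & forall i, a <= y i l t <= b].
Proof.
move=> gt.
have H : ~ outside l t by move=> ol; apply: gt; exists l => //; right.
have IE r : ~ (~` I) r -> a <= r <= b.
  by move=> /contrapT; rewrite /I/= in_itv.
split; last (move=> i); apply: IE => K; apply: H.
- by left; left.
- by left; right.
- by right; rewrite -bigcup_seq_cond; exists i; rewrite /= ?mem_index_enum.
Qed.

Lemma accurate_with_high_probability :
  with_probability_at_least P (1 - delta)
    [set t | accurate a b delta (fun l => x1 l t) (fun l => x2 l t)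
       (fun i l => y i l t) (arm_mean nu)].
Proof.
have mbad : measurable (\bigcup_k bad k) by exact: bigcup_measurable.
exists good; split.
- exact: measurableC.
- move=> t gt /=.
  have p01 i : 0 <= p i <= 1.
    have /andP[ya yb] := mean_supported a_ge0 ab (nu_ab i).
    by rewrite divr_ge0 ?subr_ge0 ?(ltW ab)//= ler_pdivrMr ?mul1r ?subr_gt0// lerB.
  have ba : b - a != 0 by rewrite gt_eqF ?subr_gt0.
  rewrite (_ : arm_mean nu = fun i => a + (b - a) * p i); last first.
    by apply/funext => i; rewrite /p; field.
  rewrite (_ : (fun l => x1 l t) = fun l => a + (b - a) * clip (x1 l t)); last first.
    by apply/funext => l; rewrite clipE//; have [] := good_inside l gt.
  rewrite (_ : (fun l => x2 l t) = fun l => a + (b - a) * clip (x2 l t)); last first.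
    by apply/funext => l; rewrite clipE//; have [] := good_inside l gt.
  rewrite (_ : (fun i l => y i l t) = fun i l => a + (b - a) * clip (y i l t)); last first.
    by apply/funext => i; apply/funext => l; rewrite clipE//; have [] := good_inside l gt.
  apply: accurate_affine => //.
    by move=> l; rewrite clip_ge0 clip_le1.
  move=> m m0 /=; split.
  - by move=> i; exact: (good_mean (inl i) gt m0).
  - exact: (good_mean (inr None) gt m0).
  - exact: (good_mean (inr (Some false)) gt m0).
  - exact: (good_mean (inr (Some true)) gt m0).
- rewrite [leRHS]probability_setC// EFinB leeB//.
  apply: le_trans (measure_sigma_subadditive P measurable_bad mbad (@subset_refl _ _)) _.
  apply: nneseries_telescope_le => //; first by case/andP: delta01 => /ltW.
Qed.
End GoodEvent.

(** * The run of the algorithm on accurate estimates *)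

Section SelfBounding.
Context (R : realType).

(** Equivalently [u <= expR (u / 2)], and [expR (u / 2) >= (1 + u / 4)^2 = u + (1 - u / 4)^2]. *)
Lemma ln_le_half (u : R) : 0 < u -> ln u <= u / 2.
Proof.
move=> u0; rewrite -ler_expR lnK// (_ : u / 2 = u / 4 + u / 4); last by field.
have v0 : 0 <= 1 + u / 4 by lra.
have v1 := expR_ge1Dx (u / 4).
rewrite expRD; apply: le_trans (ler_pM v0 v0 v1 v1).
by have := sqr_ge0 (1 - u / 4); lra.
Qed.

Lemma log1_ge1 (x : R) : 1 <= log1 x.
Proof. by rewrite /log1 le_max lexx. Qed.

Definition self_bound (A B : R) : R := A * (2 * `|ln (B * A)| + 2).

Lemma self_bound_ge0 A B : 0 <= A -> 0 <= self_bound A B.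
Proof. by move=> A0; rewrite mulr_ge0// addr_ge0// mulr_ge0. Qed.

(** Writing [m = W A u] turns the hypothesis into [u <= ln (B A) + ln (s W) + ln u]; the last term
    is absorbed by [ln u <= u / 2]. *)
Lemma self_boundP (A B s W m : R) : 0 < A -> 0 < B -> 0 < s -> 0 < W -> 0 < m ->
  m <= W * A * ln (B * s * m) -> m <= self_bound A B * (W * log1 (s * W)).
Proof.
move=> A0 B0 s0 W0 m0 mle.
have WA : 0 < W * A by rewrite mulr_gt0.
have [u u0 mE] : exists2 u, 0 < u & m = W * A * u.
  by exists (m / (W * A)); rewrite ?divr_gt0// mulrC divfK// gt_eqF.
have : u <= ln (B * A) + ln (s * W) + ln u.
  rewrite -!lnM ?posrE ?mulr_gt0// -(ler_pM2l WA) -mE.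
  apply: le_trans mle _; rewrite mE le_eqVlt; apply/orP; left.
  by apply/eqP; congr (_ * ln _); ring.
have := ln_le_half u0 => h1 h2.
have h3 : ln (s * W) <= log1 (s * W) by rewrite /log1 le_max lexx orbT.
have h4 := log1_ge1 (s * W).
have h5 := ler_norm (ln (B * A)).
have h6 := normr_ge0 (ln (B * A)).
have : u <= (2 * `|ln (B * A)| + 2) * log1 (s * W).
  have : `|ln (B * A)| <= `|ln (B * A)| * log1 (s * W) by rewrite ler_peMr.
  by lra.
move=> /(ler_wpM2l (ltW WA)); rewrite -mE /self_bound => /le_trans; apply.
by rewrite le_eqVlt; apply/orP; left; apply/eqP; ring.
Qed.
End SelfBounding.

Section ConfidenceTheory.
Context (R : realType) (n : nat) (n_gt0 : (0 < n)%N) (delta : R).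
Hypothesis delta01 : 0 < delta < 1.
Local Notation cf := (confidence n delta).
Local Notation L t := (ln (1 / delta_at n delta t)).

Lemma confidence_ge0 t m : 0 <= cf t m. Proof. exact: sqrtr_ge0. Qed.

Lemma sqr_confidence t m : (0 < t)%N -> (0 < m)%N ->
  cf t m ^+ 2 = L t / (2 * m%:R).
Proof.
move=> t0 m0; rewrite sqr_sqrtr// divr_ge0 ?mulr_ge0//.
exact/ltW/ln_inv_delta_at_gt0.
Qed.

Lemma confidence_gt0 t m : (0 < t)%N -> (0 < m)%N -> 0 < cf t m.
Proof.
move=> t0 m0; rewrite sqrtr_gt0 divr_gt0 ?mulr_gt0 ?ltr0n//.
exact: ln_inv_delta_at_gt0.
Qed.

Lemma le_confidence s t m : (0 < s)%N -> (s <= t)%N -> cf s m <= cf t m.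
Proof.
move=> s0 st; have t0 := leq_trans s0 st; have /andP[d0 _] := delta01.
apply: ler_wsqrtr; apply: ler_wpM2r; first by rewrite invr_ge0 mulr_ge0.
have D u (u0 : (0 < u)%N) : 1 / delta_at n delta u \is Num.pos.
  by rewrite posrE divr_gt0// delta_at_gt0.
rewrite ler_ln; [|exact: D..].
rewrite !inv_delta_at//.
rewrite ler_pM2r ?invr_gt0 ?mulr_gt0//.
apply: ler_wpM2l; first by rewrite mulr_ge0 ?sqr_ge0// addr_ge0.
by rewrite lerXn2r ?nnegrE// ler_nat.
Qed.

(** Since [pi <= 4] and [n >= 1], the prefactor [(n + 4) pi^2 / 3] is at most [36 n], whose root
    gives the 6. *)
Lemma ln_inv_delta_at_le t : (0 < t)%N ->
  L t <= 2 * ln (6 * Num.sqrt (n%:R / delta) * t%:R).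
Proof.
move=> t0; have /andP[d0 _] := delta01.
have nd0 : 0 < n%:R / delta by rewrite divr_gt0 ?ltr0n.
have s0 : 0 < 6 * Num.sqrt (n%:R / delta) * t%:R.
  by rewrite !mulr_gt0 ?sqrtr_gt0 ?ltr0n.
rewrite mulr_natl -lnXn// ler_ln ?posrE ?exprn_gt0//; last first.
  by rewrite div1r invr_gt0 delta_at_gt0.
rewrite inv_delta_at// !exprMn (sqr_sqrtr (ltW nd0)).
rewrite (_ : 6 ^+ 2 * (n%:R / delta) * t%:R ^+ 2 = 36 * n%:R / delta * t%:R ^+ 2); last by ring.
rewrite [leLHS](_ : _ = (n%:R + 4) * pi ^+ 2 / 3 / delta * t%:R ^+ 2); last first.
  by move: (pi : R) => p; field; rewrite gt_eqF.
rewrite ler_wpM2r ?sqr_ge0// ler_wpM2r ?invr_ge0 ?(ltW d0)//.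
have n1 : 1 <= n%:R :> R by rewrite ler1n.
have p4 : (pi : R) <= 4 by have := pihalf_lt2 R; lra.
have p0 := pi_ge0 R.
have : pi ^+ 2 <= 16 :> R by move: p4 p0; move: (pi : R) => p; nra.
by move: (pi ^+ 2 : R) => p2; nra.
Qed.

Lemma confidence_inv t m x c : (0 < t)%N -> (0 < m)%N -> 0 < x ->
  x <= c * cf t m -> m%:R <= c ^+ 2 * (1 / x ^+ 2) * (L t / 2).
Proof.
move=> t0 m0 x0 xc; have m1 : 0 < m%:R :> R by rewrite ltr0n.
have : x ^+ 2 <= (c * cf t m) ^+ 2 by rewrite lerXn2r ?nnegrE ?(ltW x0)// (le_trans (ltW x0)).
rewrite exprMn sqr_confidence// => H.
have x2 : 0 < x ^+ 2 by rewrite exprn_gt0.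
rewrite (_ : c ^+ 2 * _ * _ = c ^+ 2 * (L t / 2) / x ^+ 2); last first.
  by field; rewrite gt_eqF.
rewrite ler_pdivlMr// mulrC -ler_pdivlMr//; apply: le_trans H _.
rewrite le_eqVlt; apply/orP; left; apply/eqP; field; rewrite gt_eqF//.
Qed.

Lemma confidence_lt t m1 m2 : (0 < m1)%N -> (0 < m2)%N -> (0 < t)%N ->
  cf t m1 < cf t m2 -> (m2 < m1)%N.
Proof.
move=> m10 m20 t0; rewrite -(ltr_pXn2r (n := 2))// ?nnegrE ?confidence_ge0//.
rewrite !sqr_confidence// ltr_pM2l ?ln_inv_delta_at_gt0//.
by rewrite ltf_pV2 ?posrE ?mulr_gt0 ?ltr0n// ltr_pM2l// ltr_nat.
Qed.

Lemma confidence_ratio t m1 m2 c : (0 < m1)%N -> (0 < m2)%N -> (0 < t)%N ->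
  cf t m1 <= c * cf t m2 -> m2%:R <= c ^+ 2 * m1%:R.
Proof.
move=> m10 m20 t0 H; have L0 := ln_inv_delta_at_gt0 n delta01 t0.
have := confidence_inv t0 m20 (confidence_gt0 t0 m10) H.
rewrite sqr_confidence// => /le_trans; apply.
rewrite le_eqVlt; apply/orP; left; apply/eqP; field.
by rewrite !gt_eqF ?ltr0n.
Qed.
End ConfidenceTheory.

(** * Bounds on the gaps, on sigma and on the radii *)

Section Gaps.
Context (R : realType) (n : nat) (n_gt0 : (0 < n)%N) (a b k : R) (ym : 'I_n -> R).
Hypotheses (k_ge0 : 0 <= k) (ym_ab : forall i, a <= ym i <= b).
Hypothesis gap_gt0 : forall i, 0 < gap k ym i.

(** With zero deviation every mean equals their average, which is then the threshold, and the gaps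
    vanish. *)
Lemma sigma_arms_gt0 : 0 < sigma_arms ym.
Proof.
rewrite lt0r sqrtr_ge0 andbT; apply/negP => /eqP s0.
have := gap_gt0 (Ordinal n_gt0); rewrite /gap /threshold s0 mulr0 addr0.
have nR : 0 < n%:R :> R by rewrite ltr0n.
have : sigma_arms ym ^+ 2 = 0 by rewrite s0 expr0n.
rewrite sqr_sqrtr; last first.
  by rewrite mulr_ge0 ?invr_ge0// sumr_ge0// => i _; exact: sqr_ge0.
move/eqP; rewrite mulf_eq0 invr_eq0 gt_eqF//= psumr_eq0; last by move=> i _; exact: sqr_ge0.
move=> /allP /(_ (Ordinal n_gt0)); rewrite mem_index_enum => /(_ isT).
by rewrite sqrf_eq0 => /eqP ->; rewrite normr0 ltxx.
Qed.

Lemma mu_arms_itv : a <= mu_arms ym <= b.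
Proof.
have nR : 0 < n%:R :> R by rewrite ltr0n.
rewrite /mu_arms mulrC ler_pdivlMr// ler_pdivrMr//.
have E (c : R) : c * n%:R = \sum_(i < n) c by rewrite sumr_const card_ord mulr_natr.
by rewrite !E !ler_sum// => i _; case/andP: (ym_ab i).
Qed.

Lemma sigma_arms_le : sigma_arms ym <= b - a.
Proof.
have /andP[ma mb] := mu_arms_itv.
have ba : 0 <= b - a by lra.
rewrite -[leRHS]ger0_norm// -sqrtr_sqr; apply: ler_wsqrtr.
have nR : 0 < n%:R :> R by rewrite ltr0n.
rewrite mulrC ler_pdivrMr// mulr_natr -[in leRHS](card_ord n) -sumr_const.
apply: ler_sum => i _; have /andP[ya yb] := ym_ab i.
by rewrite -subr_ge0 subr_sqr mulr_ge0//; lra.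
Qed.

Lemma gap_le K i : k <= K -> gap k ym i <= (b - a) * (1 + K).
Proof.
move=> kK; have /andP[ma mb] := mu_arms_itv; have /andP[ya yb] := ym_ab i.
have s1 := sigma_arms_le; have s0 := sigma_arms_gt0.
have : `|ym i - mu_arms ym| <= b - a by rewrite ler_norml; apply/andP; split; lra.
have -> : gap k ym i = `|(ym i - mu_arms ym) - k * sigma_arms ym|.
  by rewrite /gap /threshold; congr `|_|; ring.
have := ler_normB (ym i - mu_arms ym) (k * sigma_arms ym).
rewrite (ger0_norm (mulr_ge0 k_ge0 (ltW s0))).
have : k * sigma_arms ym <= K * (b - a) by rewrite ler_pM// ltW.
lra.
Qed.

Lemma gap_min_le i : gap_min n_gt0 k ym <= gap k ym i.
Proof. exact: bigmin_le. Qed.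

Lemma gap_min_gt0 : 0 < gap_min n_gt0 k ym.
Proof. by apply: (big_ind (fun x => 0 < x)) => // x z x0 z0; rewrite lt_min x0 z0. Qed.

Lemma kappa_ge1 : 1 <= kappa k ym.
Proof. by rewrite /kappa le_max lexx. Qed.

(** This is [(1 + w)^2 <= 2 + 2 w^2] with [w = 5 q k / sigma]; both 1 and [(k / sigma)^2] are at
    most [kappa]. *)
Lemma sqr_ratio_le (q : R) :
  (1 + 5 * q * (k / sigma_arms ym)) ^+ 2 <= (2 + 50 * q ^+ 2) * kappa k ym.
Proof.
have h1 := kappa_ge1.
have h2 : (k / sigma_arms ym) ^+ 2 <= kappa k ym by rewrite /kappa le_max lexx orbT.
set z := k / _ in h2 *; set w := kappa _ _ in h1 h2 *.
have q2 := sqr_ge0 q.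
have := sqr_ge0 (1 - 5 * q * z) => h3.
have := ler_wpM2l q2 h2 => h4.
lra.
Qed.
End Gaps.

Section Estimators.
Context (R : realType) (n : nat) (n_gt0 : (0 < n)%N) (a b k delta : R).
Context (x1 x2 : nat -> R) (y : 'I_n -> nat -> R) (ym : 'I_n -> R).
Hypotheses (a_ge0 : 0 <= a) (ab : a < b) (k_ge0 : 0 <= k).
Hypothesis delta01 : 0 < delta < 1.
Hypothesis gap_gt0 : forall i, 0 < gap k ym i.
Hypothesis acc : accurate a b delta x1 x2 y ym.
Implicit Types st : ade_state R n.

Local Notation cf := (confidence n delta).
Local Notation eps := (eps_sigma n a b delta).
Local Notation sigma := (sigma_arms ym).
Let r : R := b - a.
Let q : R := a + 3 * b.

Let r_gt0 : 0 < r. Proof. by rewrite subr_gt0. Qed.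
Let q_ge0 : 0 <= q. Proof. by rewrite /q; move: a_ge0 ab; lra. Qed.
Let sigma_gt0 : 0 < sigma. Proof. exact: sigma_arms_gt0 gap_gt0. Qed.

Lemma range_sigma : range2 a b + 2 * b * Defs.range1 a b = r * q.
Proof. by rewrite /range2 /Defs.range1 /r /q; ring. Qed.

Let epsE t m : eps t m = r * q * cf t m.
Proof. by rewrite /eps_sigma range_sigma. Qed.

Let eps_ge0 t m : 0 <= eps t m.
Proof. by rewrite epsE !mulr_ge0 ?confidence_ge0// ltW. Qed.

Lemma sigma_dev t m : (0 < m)%N -> (m <= t)%N ->
  `|sigma_hat x1 x2 m ^+ 2 - sigma ^+ 2| <= 6 * eps t m.
Proof.
move=> m0 mt; have [_ _ H] := acc m0; apply: le_trans H _.
rewrite !epsE ler_pM2l// ler_wpM2l ?mulr_ge0 ?(ltW r_gt0)//.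
exact: le_confidence.
Qed.

(** From [sigma^2 - sigma_hat^2 <= 6 eps], the sum [sigma_hat^2 + eps] is at least [sigma^2 / 6],
    leaving a factor 2 of slack. *)
Lemma usigma_term_ge t m : (0 < m)%N -> (m <= t)%N ->
  ((sigma ^+ 2 / 12)%:E <= usigma_term n a b delta x1 x2 t m)%E.
Proof.
move=> m0 mt; rewrite /usigma_term gtn_eqF// lee_fin.
have := sigma_dev m0 mt; rewrite ler_norml => /andP[H _].
have := sqr_ge0 (sigma_hat x1 x2 m); have := sqr_ge0 sigma; lra.
Qed.

Section Radius.
Variables (st : ade_state R n) (u : R).
Hypotheses (mtheta_gt0 : (0 < mtheta st)%N) (mtheta_le : (mtheta st <= round st)%N).
Hypothesis uE : usigma st = u%:E.
Hypothesis u_ge : sigma ^+ 2 / 12 <= u.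

Local Notation t := (round st).
Local Notation m := (mtheta st).
Local Notation rth := (r_theta a b k delta st).

Let u_gt0 : 0 < u.
Proof. by apply: lt_le_trans u_ge; rewrite divr_gt0// exprn_gt0. Qed.

Let rthE : rth = (r + Num.sqrt 2 * k * (r * q / Num.sqrt u)) * cf t m.
Proof. by rewrite /r_theta range_sigma uE. Qed.

Lemma r_theta_ge : r * cf t m <= rth.
Proof.
rewrite rthE ler_wpM2r ?confidence_ge0// lerDl.
by rewrite !mulr_ge0 ?invr_ge0 ?sqrtr_ge0// ltW.
Qed.

(** The 5 bounds the product of [sqrt 2] and the [sqrt 12] coming from [u >= sigma^2 / 12]. *)
Lemma r_theta_le : rth <= r * (1 + 5 * q * (k / sigma)) * cf t m.
Proof.
rewrite rthE; apply: ler_wpM2r; first exact: confidence_ge0.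
rewrite [leRHS](_ : _ = r + r * (5 * q * (k / sigma))); last by ring.
rewrite lerD2l.
have su : 0 < Num.sqrt u by rewrite sqrtr_gt0.
have H : Num.sqrt 2 / Num.sqrt u <= 5 / sigma.
  rewrite ler_pdivrMr// mulrAC ler_pdivlMr//.
  rewrite -(ler_pXn2r (n := 2))// ?nnegrE ?mulr_ge0 ?sqrtr_ge0 ?(ltW sigma_gt0)//.
  rewrite !exprMn (sqr_sqrtr (ltW u_gt0)) (sqr_sqrtr (ler0n R 2)).
  by move: u_ge; have := sqr_ge0 sigma; lra.
have K : 0 <= k * (r * q) by rewrite !mulr_ge0// ltW.
have -> : Num.sqrt 2 * k * (r * q / Num.sqrt u) =
  k * (r * q) * (Num.sqrt 2 / Num.sqrt u) by ring.
have -> : r * (5 * q * (k / sigma)) = k * (r * q) * (5 / sigma) by ring.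
exact: ler_wpM2l.
Qed.

Hypothesis u_le : u <= sigma_hat x1 x2 m ^+ 2 + eps t m.

Lemma theta_dev : `|theta_hat k x1 x2 m - threshold k ym| <= 7 * rth.
Proof.
have [_ Hmu _] := acc mtheta_gt0.
have {}Hmu : `|mu_hat x1 m - mu_arms ym| <= 6 * (r * cf t m).
  apply: le_trans Hmu _; rewrite ler_pM2l// ler_pM2l//.
  exact: le_confidence.
have Hs := sigma_dev mtheta_gt0 mtheta_le.
have su : 0 < Num.sqrt u by rewrite sqrtr_gt0.
have ule := u_le.
set sh := sigma_hat x1 x2 m in ule Hs *.
have sh0 : 0 <= sh by exact: sqrtr_ge0.
have e0 := eps_ge0 t m.
set D := `|sh - sigma|.
have D0 : 0 <= D by exact: normr_ge0.
have D1 : D * (sh + sigma) <= 6 * eps t m.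
  apply: le_trans Hs; rewrite subr_sqr normrM ler_wpM2l//; exact: ler_norm.
have D2 : D <= sh + sigma.
  rewrite /D; have := ler_normB sh sigma.
  by rewrite (ger0_norm sh0) (gtr0_norm sigma_gt0).
(* [D^2 u <= (D sh)^2 + D^2 eps <= 36 eps^2 + 6 eps^2] *)
have D3 : D * Num.sqrt u <= 7 * eps t m.
  have e7 : 0 <= 7 * eps t m by apply: mulr_ge0.
  have Du0 : 0 <= D * Num.sqrt u by rewrite mulr_ge0 ?sqrtr_ge0.
  rewrite -(ler_pXn2r (n := 2))//.
  rewrite exprMn sqr_sqrtr ?(ltW u_gt0)//.
  apply: le_trans (ler_wpM2l (sqr_ge0 D) ule) _.
  have A : D * sh <= 6 * eps t m.
    by apply: le_trans D1; rewrite ler_wpM2l// lerDl ltW.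
  have B : D ^+ 2 <= 6 * eps t m.
    by apply: le_trans D1; rewrite expr2 ler_wpM2l.
  have A2 : (D * sh) * (D * sh) <= (6 * eps t m) * (6 * eps t m).
    have Ds : 0 <= D * sh by exact: mulr_ge0.
    exact: ler_pM.
  have B2 := ler_wpM2r e0 B.
  have -> : D ^+ 2 * (sh ^+ 2 + eps t m) = D * sh * (D * sh) + D ^+ 2 * eps t m.
    by ring.
  have -> : (7 * eps t m) ^+ 2 = 49 * (eps t m * eps t m) by ring.
  have := mulr_ge0 e0 e0; lra.
(* Dividing by [sqrt u] produces the second part of [r_theta], up to the factor [sqrt 2 >= 1]
   inserted in [D5]. *)
have D4 : k * D <= 7 * (k * (r * q / Num.sqrt u) * cf t m).
  rewrite (_ : 7 * _ = k * (7 * (r * q * cf t m) / Num.sqrt u)); last by ring.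
  by apply: ler_wpM2l => //; rewrite ler_pdivlMr//; move: D3; rewrite epsE.
have s2 : 1 <= Num.sqrt 2 :> R by rewrite -[leLHS]sqrtr1 ler_sqrt// ler1n.
have D5 : k * (r * q / Num.sqrt u) * cf t m <=
    Num.sqrt 2 * k * (r * q / Num.sqrt u) * cf t m.
  rewrite -!mulrA ler_peMl//.
  by rewrite !mulr_ge0 ?invr_ge0 ?sqrtr_ge0 ?confidence_ge0// ltW.
have c0 : 0 <= r * cf t m by rewrite mulr_ge0 ?confidence_ge0// ltW.
rewrite rthE mulrDl.
rewrite (_ : _ - _ = (mu_hat x1 m - mu_arms ym) + k * (sh - sigma)); last first.
  by rewrite /theta_hat /threshold -/sh; ring.
apply: le_trans (ler_normD _ _) _; rewrite normrM (ger0_norm k_ge0) -/D.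
lra.
Qed.

(** Failing both tests puts the two estimates within one copy of each radius; their errors add
    [6 r_arm] and [7 r_theta]. *)
Lemma gap_le_radii i : (0 < marm st i)%N -> (marm st i <= round st)%N ->
  ~~ is_normal a b k delta x1 x2 y st i -> ~~ is_outlier a b k delta x1 x2 y st i ->
  gap k ym i <= 7 * r_arm a b delta st i + 8 * rth.
Proof.
move=> i0 it; rewrite /is_normal /is_outlier -!ltNge => H1 H2.
have Ht := theta_dev.
have [/(_ i) Hy _ _] := acc i0.
have {}Hy : `|y_hat y i (marm st i) - ym i| <= 6 * r_arm a b delta st i.
  apply: le_trans Hy _; rewrite ler_pM2l// ler_pM2l//.
  exact: le_confidence.
move: Hy Ht H1 H2; rewrite /gap !ler_norml => /andP[? ?] /andP[? ?] ? ?.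
by apply/andP; split; lra.
Qed.
End Radius.
End Estimators.

(** * The invariant of the run and the sample count *)

Section Constants.
Context (R : realType) (a b K : R).

(** The coefficient of [sqr_ratio_le] at [q = a + 3 b], plus 3, so that [(z^2 + 3) m_a], a bound on
    the round, is at most [rate_const * kappa * m_a]. *)
Definition rate_const : R := 5 + 50 * (a + 3 * b) ^+ 2.
(** Here 225 is the square of the 15 radii that bound the gap of an undecided arm. *)
Definition range_const : R := 225 * (b - a) ^+ 2 * rate_const.
Definition gap_const : R := ((b - a) * (1 + K)) ^+ 2.
(** The first term bounds a count just before a pull; the second pays for the pull itself. *)
Definition count_const : R :=
  self_bound range_const (18 * rate_const) + 2 * gap_const.

Lemma rate_const_ge5 : 5 <= rate_const.
Proof. by rewrite lerDl mulr_ge0// sqr_ge0. Qed.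

Lemma range_const_ge0 : 0 <= range_const.
Proof.
apply: mulr_ge0; first by rewrite mulr_ge0// sqr_ge0.
by apply: le_trans rate_const_ge5.
Qed.

Lemma count_const_ge0 : 0 <= count_const.
Proof.
by rewrite addr_ge0 ?self_bound_ge0 ?range_const_ge0// mulr_ge0// sqr_ge0.
Qed.
End Constants.

Section Run.
Context (R : realType) (n : nat) (n_gt0 : (0 < n)%N) (a b K k delta : R).
Context (x1 x2 : nat -> R) (y : 'I_n -> nat -> R) (ym : 'I_n -> R).
Hypotheses (a_ge0 : 0 <= a) (ab : a < b) (k_ge0 : 0 <= k) (kK : k <= K).
Hypothesis delta01 : 0 < delta < 1.
Hypothesis ym_ab : forall i, a <= ym i <= b.
Hypothesis gap_gt0 : forall i, 0 < gap k ym i.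
Hypothesis acc : accurate a b delta x1 x2 y ym.
Implicit Types st : ade_state R n.

Local Notation cf := (confidence n delta).
Local Notation eps := (eps_sigma n a b delta).
Local Notation sigma := (sigma_arms ym).
Local Notation kap := (kappa k ym).
Local Notation gmin := (gap_min n_gt0 k ym).
Local Notation C1 := (count_const a b K).
Local Notation c := (rate_const a b).
Local Notation rnd := (random_sample a b delta x1 x2).
Local Notation sq := (sequential_sample a b delta x1 x2).
Local Notation cls := (classify a b k delta x1 x2 y).
Local Notation rseq := (r_seq a b delta).
Local Notation rth := (r_theta a b k delta).

Let z : R := 1 + 5 * (a + 3 * b) * (k / sigma).
Let sqnd : R := Num.sqrt (n%:R / delta).

Let r_gt0 : 0 < b - a. Proof. by rewrite subr_gt0. Qed.
Let sigma_gt0 : 0 < sigma. Proof. exact: sigma_arms_gt0 gap_gt0. Qed.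
Let kap1 : 1 <= kap. Proof. exact: kappa_ge1. Qed.
Let c5 : 5 <= c. Proof. exact: rate_const_ge5. Qed.
Let sqnd_gt0 : 0 < sqnd.
Proof. by case/andP: delta01 => d0 _; rewrite sqrtr_gt0 divr_gt0 ?ltr0n. Qed.
Let z_le : z ^+ 2 <= (2 + 50 * (a + 3 * b) ^+ 2) * kap.
Proof. exact: sqr_ratio_le. Qed.

Let count_le (s W : R) : R := C1 * (W * log1 (s * W)).

(** An additive constant fits in the bound because gaps are at most [(b - a) (1 + K)], which makes
    [gap_const * W >= 1]. The upper bound [K] on [k] enters here. *)
Lemma two_le_count x s W : 0 < x -> x <= (b - a) * (1 + K) -> 1 / x ^+ 2 <= W ->
  2 <= 2 * gap_const a b K * (W * log1 (s * W)).
Proof.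
move=> x0 xK xW; have l1 := log1_ge1 (s * W).
have xx0 : 0 < x ^+ 2 by rewrite exprn_gt0.
have D : x ^+ 2 <= gap_const a b K.
  by rewrite lerXn2r// nnegrE (le_trans (ltW x0)).
have h1 : 1 <= gap_const a b K * (1 / x ^+ 2).
  by rewrite mulrA mulr1 ler_pdivlMr// mul1r.
have h2 := ler_wpM2l (sqr_ge0 ((b - a) * (1 + K))) xW.
have h3 : 1 <= gap_const a b K * W by exact: le_trans h1 h2.
have : gap_const a b K * W <= gap_const a b K * W * log1 (s * W).
  by rewrite ler_peMr//; lra.
lra.
Qed.

Lemma small_count_le x s W : 0 < x -> x <= (b - a) * (1 + K) -> 1 / x ^+ 2 <= W ->
  2 <= count_le s W.
Proof.
move=> x0 xK xW; apply: le_trans (two_le_count s x0 xK xW) _.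
have W0 : 0 <= W by apply: le_trans xW; rewrite divr_ge0// sqr_ge0.
have l1 := log1_ge1 (s * W).
rewrite /count_le ler_wpM2r//; first by rewrite mulr_ge0//; lra.
by rewrite /count_const lerDr self_bound_ge0// range_const_ge0.
Qed.

(** A gap [x] below [c0] times the confidence inverts to [m <= W A ln (B s m)], which [self_boundP]
    solves. The radius is read before the pull and the count grows by it, hence [m.+1]. *)
Lemma next_count_le t m x c0 s W : (0 < t)%N -> (0 < m)%N -> 0 < x -> 0 < s ->
  x <= (b - a) * (1 + K) -> 1 / x ^+ 2 <= W ->
  x <= c0 * cf t m -> c0 ^+ 2 * (1 / x ^+ 2) <= W * range_const a b ->
  6 * sqnd * t%:R <= 18 * c * s * m%:R ->
  m.+1%:R <= count_le s W.
Proof.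
move=> t0 m0 x0 s0 xK xW xc cW tm.
have m1 : 0 < m%:R :> R by rewrite ltr0n.
have t1 : 0 < t%:R :> R by rewrite ltr0n.
have W0 : 0 < W by apply: lt_le_trans xW; rewrite divr_gt0// exprn_gt0.
have A0 : 0 < range_const a b.
  by rewrite /range_const !mulr_gt0 ?exprn_gt0//; move: c5; lra.
have cgt0 : 0 < c by move: c5; lra.
have B0 : 0 < 18 * c by rewrite mulr_gt0.
have h1 := confidence_inv delta01 t0 m0 x0 xc.
have h2 : ln (1 / delta_at n delta t) / 2 <= ln (18 * c * s * m%:R).
  rewrite ler_pdivrMr// [leRHS]mulrC.
  apply: le_trans (ln_inv_delta_at_le n_gt0 delta01 t0) _.
  by rewrite ler_pM2l// ler_ln ?posrE ?mulr_gt0.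
have h3 : 0 <= ln (1 / delta_at n delta t) / 2.
  by rewrite divr_ge0// ltW// ln_inv_delta_at_gt0.
have h4 : m%:R <= W * range_const a b * ln (18 * c * s * m%:R).
  apply: le_trans h1 _; apply: ler_pM => //.
  by rewrite mulr_ge0 ?divr_ge0 ?sqr_ge0.
have h5 := self_boundP A0 B0 s0 W0 m1 h4.
have h6 := two_le_count s x0 xK xW.
rewrite -natr1 /count_le /count_const mulrDl.
by apply: lerD h5 _; lra.
Qed.

(** The [+ 1] in [inv_theta_le] accounts for the latest random sample, the radii being compared
    before it. The count bound [inv_marm] covers removed arms as well, whose counts are frozen. *)
Record run_inv st : Prop := RunInv {
  inv_round : round st = (mtheta st + mseq st).+1;
  inv_seq_gt0 : (0 < mseq st)%N;
  inv_seq_le : (mseq st <= mtheta st)%N;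
  inv_theta_le : (mtheta st)%:R <= z ^+ 2 * (mseq st)%:R + 1;
  inv_cand : forall i, i \in cand st -> marm st i = mseq st;
  inv_usigma : exists u, [/\ usigma st = u%:E, sigma ^+ 2 / 12 <= u &
    u <= sigma_hat x1 x2 (mtheta st) ^+ 2 + eps (round st) (mtheta st)];
  inv_mtheta : (mtheta st)%:R <= count_le sqnd (kap * (1 / gmin ^+ 2));
  inv_marm : forall i, (marm st i)%:R <= count_le (sqnd * kap) (1 / gap k ym i ^+ 2) }.

(* Before the first classification both counts are 1; afterwards the candidates are
   the arms which passed neither test. *)
Definition undecided st : Prop := forall i, i \in cand st ->
  (mtheta st = 1%N /\ mseq st = 1%N) \/ gap k ym i <= 7 * rseq st + 8 * rth st.

Let gmin_gt0 : 0 < gmin. Proof. exact: gap_min_gt0. Qed.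
Let gap_leK i : gap k ym i <= (b - a) * (1 + K).
Proof. exact: gap_le. Qed.
Let gmin_leK : gmin <= (b - a) * (1 + K).
Proof. exact: le_trans (gap_min_le n_gt0 k ym (Ordinal n_gt0)) (gap_leK _). Qed.

Let inv_gmin_le : 1 / gmin ^+ 2 <= kap * (1 / gmin ^+ 2).
Proof. by rewrite ler_peMl// divr_ge0// sqr_ge0. Qed.

Lemma usigma_step (U : \bar R) t m : ((sigma ^+ 2 / 12)%:E <= U)%E ->
  (0 < m)%N -> (m <= t)%N ->
  exists u, [/\ Order.min U (usigma_term n a b delta x1 x2 t m) = u%:E,
    sigma ^+ 2 / 12 <= u & u <= sigma_hat x1 x2 m ^+ 2 + eps t m].
Proof.
move=> U0 m0 mt; have := usigma_term_ge a_ge0 ab delta01 acc m0 mt.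
rewrite /usigma_term gtn_eqF//; set v := _ + _.
rewrite lee_fin => v0; case: U U0 => [u| |].
- rewrite lee_fin => u0; exists (Num.min u v); rewrite -EFin_min; split => //.
    by rewrite le_min u0.
  by rewrite ge_min lexx orbT.
- by move=> _; exists v; rewrite min_r ?leey.
- by rewrite leNgt ltNye.
Qed.

Lemma run_inv_radii st : run_inv st ->
  [/\ (b - a) * cf (round st) (mtheta st) <= rth st &
      rth st <= (b - a) * z * cf (round st) (mtheta st)].
Proof.
move=> [_ _ _ _ _ [u [uE u0 _]] _ _]; split.
- exact: r_theta_ge uE.
- exact: r_theta_le uE u0.
Qed.

(** From [r_a <= r_theta] and the upper bound on [r_theta] follows [m_theta <= z^2 m_a] before the
    sample. A remaining candidate gives [gmin <= 15 r_theta], which bounds the new [m_theta]. *)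
Lemma run_inv_random st : run_inv st -> undecided st -> cand st != finset.set0 ->
  rseq st <= rth st -> run_inv (rnd st).
Proof.
move=> I und /set0Pn[i0 ci0] le_r.
have [rge rle] := run_inv_radii I.
case: I => Hr Hs Hst Hz Hc [u [uE u0 u1]] Hmt Hma.
have mt0 : (0 < mtheta st)%N by exact: leq_trans Hst.
have t0 : (0 < round st)%N by rewrite Hr.
have rat : (mtheta st)%:R <= z ^+ 2 * (mseq st)%:R.
  apply: (confidence_ratio delta01 Hs mt0 t0); rewrite -(ler_pM2l r_gt0) mulrA.
  exact: le_trans le_r rle.
split => //=.
- by rewrite Hr.
- exact: leqW.
- by rewrite -natr1 lerD2r.
- apply: usigma_step => //; first by rewrite uE lee_fin.
  by rewrite Hr ltnS -addnS leq_addr.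
(* Right after initialization no test has been made, but the new count is only 2. *)
case: (und i0 ci0) => [[-> _]|gi].
  exact: small_count_le gmin_gt0 gmin_leK inv_gmin_le.
apply: (@next_count_le (round st) _ gmin (15 * ((b - a) * z))) => //.
- apply: le_trans (gap_min_le n_gt0 k ym i0) _; rewrite -mulrA; lra.
- rewrite [leRHS](_ : _ = 225 * (b - a) ^+ 2 * (1 / gmin ^+ 2) * (c * kap)); last first.
    by rewrite /range_const; ring.
  rewrite [leLHS](_ : _ = 225 * (b - a) ^+ 2 * (1 / gmin ^+ 2) * z ^+ 2); last by ring.
  apply: ler_wpM2l; first by rewrite mulr_ge0 ?divr_ge0 ?sqr_ge0// mulr_ge0 ?sqr_ge0.
  apply: le_trans z_le _; apply: ler_wpM2r; first by move: kap1; lra.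
  by rewrite /rate_const; lra.
(* The round [m_theta + m_a + 1] is at most [3 m_theta], so no [kappa] is added to the logarithm's
   scale. *)
- have : (round st)%:R <= 3 * (mtheta st)%:R :> R.
    by rewrite -natrM ler_nat Hr; move: Hst mt0; move: (mtheta st) (mseq st); clear; lia.
  move=> /(ler_wpM2l (ltW sqnd_gt0)) h.
  have m0 : 0 <= sqnd * (mtheta st)%:R by rewrite mulr_ge0// ltW.
  have c5' : 1 <= c by move: c5; lra.
  have := ler_wpM2r m0 c5'; lra.
Qed.

(** As [r_theta] is at least the plain radius [r * cf] at [m_theta], the test [r_theta < r_a] forces
    [m_a < m_theta], so [m_a <= m_theta] survives the pull. *)
Lemma run_inv_sequential st : run_inv st -> undecided st ->
  rth st < rseq st -> run_inv (sq st).
Proof.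
move=> I und lt_r.
have [rge rle] := run_inv_radii I.
case: I => Hr Hs Hst Hz Hc [u [uE u0 u1]] Hmt Hma.
have mt0 : (0 < mtheta st)%N by exact: leq_trans Hst.
have t0 : (0 < round st)%N by rewrite Hr.
have lt_m : (mseq st < mtheta st)%N.
  apply: (confidence_lt delta01 mt0 Hs t0); rewrite -(ltr_pM2l r_gt0).
  exact: le_lt_trans rge lt_r.
split => //=.
- by rewrite Hr addnS.
- by apply: le_trans Hz _; rewrite lerD2r ler_wpM2l ?sqr_ge0// ler_nat.
- by move=> i ci; rewrite ffunE ci addn1 Hc.
- apply: usigma_step => //; first by rewrite uE lee_fin.
  by rewrite Hr; apply: leq_trans (leq_addr _ _) (leqW (leqnSn _)).
move=> i; rewrite ffunE; have [ci|_] := boolP (i \in cand st); last first.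
  by rewrite addn0.
rewrite addn1 Hc//.
case: (und i ci) => [[_ ->]|gi].
  exact: small_count_le (gap_gt0 i) (gap_leK i) (lexx _).
have s0 : 0 < sqnd * kap by rewrite mulr_gt0//; move: kap1; lra.
apply: (@next_count_le (round st) _ (gap k ym i) (15 * (b - a))) => //.
- by apply: le_trans gi _; rewrite -mulrA -[(b - a) * _]/(rseq st); move: lt_r; lra.
- rewrite [leRHS](_ : _ = 225 * (b - a) ^+ 2 * (1 / gap k ym i ^+ 2) * c); last first.
    by rewrite /range_const; ring.
  rewrite [leLHS](_ : _ = 225 * (b - a) ^+ 2 * (1 / gap k ym i ^+ 2) * 1); last by ring.
  apply: ler_wpM2l; first by rewrite mulr_ge0 ?divr_ge0 ?sqr_ge0// mulr_ge0 ?sqr_ge0.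
  by move: c5; lra.
- have m1 : 1 <= (mseq st)%:R :> R by rewrite ler1n.
  (* Here [t <= (z^2 + 3) m_a]; this is how [kappa] enters the logarithms of the individual arms. *)
  have h : (round st)%:R <= c * kap * (mseq st)%:R.
    rewrite Hr -natr1 natrD.
    have : (z ^+ 2 + 3) * (mseq st)%:R <= c * kap * (mseq st)%:R.
      apply: ler_wpM2r => //; apply: (@le_trans _ _ ((2 + 50 * (a + 3 * b) ^+ 2) * kap + 3 * kap)).
        by apply: lerD z_le _; move: kap1; lra.
      by rewrite /rate_const; lra.
    by move: Hz; lra.
  have {}h := ler_wpM2l (ltW sqnd_gt0) h.
  have : 0 <= sqnd * (c * kap * (mseq st)%:R).
    by rewrite !mulr_ge0 ?(ltW sqnd_gt0)//; move: c5 kap1; lra.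
  lra.
Qed.

Lemma run_inv_classify st : run_inv st -> run_inv (cls st) /\ undecided (cls st).
Proof.
move=> I; split.
  case: I => Hr Hs Hst Hz Hc Hu Hmt Hma; split => //= i.
  by rewrite finset.in_setD => /andP[_]; exact: Hc.
case: I => Hr Hs Hst Hz Hc [u [uE u0 u1]] _ _.
have mt0 : (0 < mtheta st)%N by exact: leq_trans Hst.
move=> i; rewrite /= !inE; case/andP; rewrite negb_or => /andP[h1 h2] ci; right.
move: h1 h2; rewrite ci/= => h1; rewrite h1 /= => h2.
have [mr mi] : (mtheta st <= round st)%N /\ (marm st i <= round st)%N.
  by rewrite Hr Hc//; move: (mtheta st) (mseq st); clear; lia.
have := gap_le_radii n_gt0 a_ge0 ab k_ge0 delta01 gap_gt0 acc mt0 mr uE u0 u1 _ mi h1 h2.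
by rewrite /r_arm Hc// => /(_ Hs).
Qed.

Lemma run_inv_init :
  run_inv (ade_init n a b delta x1 x2) /\ undecided (ade_init n a b delta x1 x2).
Proof.
split; last by move=> i _; left.
have z1 : 1 <= z.
  rewrite lerDl mulr_ge0 ?divr_ge0 ?(ltW sigma_gt0)// mulr_ge0//.
  by move: a_ge0 ab; lra.
have [g1 g2] : 1 <= count_le sqnd (kap * (1 / gmin ^+ 2)) /\
    forall i, 1 <= count_le (sqnd * kap) (1 / gap k ym i ^+ 2).
  split; first by have := small_count_le sqnd gmin_gt0 gmin_leK inv_gmin_le; lra.
  by move=> i; have := small_count_le (sqnd * kap) (gap_gt0 i) (gap_leK i) (lexx _); lra.
split => //=.
- by have := exprn_ege1 2 z1; lra.
- by move=> i _; rewrite !ffunE inE.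
- apply: usigma_step => //.
  have [|u [-> u0 _]] := @usigma_step (usigma_term n a b delta x1 x2 1 0) 2 1 _ isT isT.
    exact: leey.
  by rewrite lee_fin.
- by move=> i; rewrite !ffunE inE.
Qed.

Lemma run_inv_run s :
  let st := ade_run a b k delta x1 x2 y s in run_inv st /\ undecided st.
Proof.
elim: s => [|s [I und]]; first exact: run_inv_init.
rewrite /ade_run iterS -/(ade_run a b k delta x1 x2 y s).
case: ifPn => // c0; rewrite /loop_body; apply: run_inv_classify.
by have [h|h] := leP (rseq _) (rth _); [exact: run_inv_random|exact: run_inv_sequential].
Qed.

Lemma round_run s : cand (ade_run a b k delta x1 x2 y s) != finset.set0 ->
  round (ade_run a b k delta x1 x2 y s) = (s + 3)%N.
Proof.
elim: s => [//|s IH]; rewrite /ade_run iterS -/(ade_run a b k delta x1 x2 y s).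
case: ifPn => [/eqP -> /eqP//|c0 _].
by rewrite /loop_body /=; case: ifP => _ /=; rewrite IH.
Qed.

(** The invariant bounds both kinds of counts at the halting state; a random sample costs two pulls,
    hence the factor 2. *)
Lemma ade_halts_within : halts_within a b k delta x1 x2 y
  ((2 * C1 + 1) * ade_bound n_gt0 k delta ym).
Proof.
have [s cs] : exists s, cand (ade_run a b k delta x1 x2 y s) = finset.set0.
  (* If candidates remained after [2 N + 1] iterations, with [N] the truncation of [M], the round
     would be [2 N + 4] and [m_theta + m_a = 2 N + 3], although [m_a <= m_theta <= N]. *)
  pose M := count_le sqnd (kap * (1 / gmin ^+ 2)).
  exists (2 * Num.truncn `|M|).+1; apply/eqP; apply/negPn/negP => c0.
  have := round_run c0; have [[-> _ h1 _ _ _ h2 _] _] := run_inv_run (2 * Num.truncn `|M|).+1.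
  set st := ade_run _ _ _ _ _ _ _ _ in h1 h2 *.
  have : (mtheta st <= Num.truncn `|M|)%N.
    by rewrite -ltnS -(ltr_nat R); apply: le_lt_trans h2 (le_lt_trans (ler_norm _) (truncnS_gt _)).
  move: h1; move: (mtheta st) (mseq st) (Num.truncn _); clear; lia.
exists s; split => //; have [[_ _ _ _ _ _ h1 h2] _] := run_inv_run s.
set st := ade_run _ _ _ _ _ _ _ _ in h1 h2 *.
have C0 := count_const_ge0 a b K.
rewrite /num_samples natrD natrM natr_sum.
have h3 : \sum_(i < n) (marm st i)%:R <=
    C1 * \sum_(i < n) 1 / gap k ym i ^+ 2 * log1 (sqnd * (1 / gap k ym i ^+ 2) * kap).
  rewrite mulr_sumr; apply: ler_sum => i _; apply: le_trans (h2 i) _.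
  by rewrite /count_le (mulrAC sqnd).
rewrite /ade_bound -/sqnd.
set S := \sum_(i < n) 1 / gap k ym i ^+ 2 * _ in h3 *.
have S0 : 0 <= S.
  apply: sumr_ge0 => i _; rewrite mulr_ge0 ?divr_ge0 ?sqr_ge0//.
  by have := log1_ge1 (sqnd * (1 / gap k ym i ^+ 2) * kap); lra.
move: h1; rewrite /count_le (mulrA sqnd) (mulrAC sqnd).
set l := log1 _ => h1.
have T0 : 0 <= kap * (1 / gmin ^+ 2) * l.
  have l1 : 1 <= l by exact: log1_ge1.
  have k0 : 0 <= kap by move: kap1; lra.
  have l0 : 0 <= l by lra.
  by rewrite mulr_ge0// mulr_ge0// divr_ge0 ?sqr_ge0.
set V := kap * _ * l in T0 h1 *.
have := mulr_ge0 C0 S0; have := mulr_ge0 C0 T0.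
rewrite mulr_natl mulr2n; lra.
Qed.
End Run.

(** * Excluding a degenerate range, and the theorem *)

Section Support.
Context (R : realType) (a b : R).

Lemma supported_in_le (m : probability (measurableTypeR R) R) :
  supported_in a b m -> a <= b.
Proof.
move=> sab; rewrite leNgt; apply/negP => ba; move: sab.
rewrite /supported_in set_itv_ge; last by rewrite bnd_simp -ltNge.
by rewrite measure0 => /eqP; rewrite eqe eq_sym oner_eq0.
Qed.

Lemma mean_supported_point (m : probability (measurableTypeR R) R) :
  supported_in a a m -> (\int[m]_x x)%R = a.
Proof.
move=> sa; rewrite /Rintegral (_ : \int[m]_x x%:E = \int[m]_x (cst a%:E x))%E.
  by rewrite integral_cst// [X in (_ * X)%E]probability_setT mule1.
apply: ae_eq_integral => //; exists (~` `[a, a]%classic); split.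
- exact: measurableC.
- by rewrite [LHS]probability_setC// [X in (_ - X)%E]sa subee.
- by move=> x /= Hx xa; apply: Hx => _; move: xa; rewrite in_itv/= => /le_anti ->.
Qed.

(** If [a = b], all means equal [a] and sigma is at most [b - a = 0], contradicting the positive
    gaps. *)
Lemma supported_in_lt (n : nat) (n_gt0 : (0 < n)%N) (k : R)
    (nu : 'I_n -> probability (measurableTypeR R) R) :
  (forall i, supported_in a b (nu i)) -> (forall i, 0 < gap k (arm_mean nu) i) ->
  a < b.
Proof.
move=> sab gap0; have := supported_in_le (sab (Ordinal n_gt0)).
rewrite le_eqVlt => /predU1P[e|//].
have mab i : a <= arm_mean nu i <= b.
  rewrite /arm_mean mean_supported_point; last by rewrite {2}e; exact: sab.
  by rewrite lexx e lexx.
have := sigma_arms_gt0 n_gt0 gap0; have := sigma_arms_le n_gt0 mab.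
by rewrite e subrr => /le_lt_trans h /h; rewrite ltxx.
Qed.
End Support.

Theorem theorem2 (R : realType) (a b K : R) (a_ge0 : 0 <= a) :
  exists C : R, 0 < C /\
  forall (n : nat) (n_gt0 : (0 < n)%N) (k delta : R)
    (nu : 'I_n -> probability (measurableTypeR R) R),
    0 <= k <= K -> 0 < delta < 1 ->
    (forall i, supported_in a b (nu i)) ->
    (forall i, 0 < gap k (arm_mean nu) i) ->
  forall (d : measure_display) (T : measurableType d) (P : probability T R)
    (arm : nat -> T -> 'I_n) (x1 x2 : nat -> {RV P >-> R})
    (y : 'I_n -> nat -> {RV P >-> R}),
    sampling_model nu arm x1 x2 y ->
    with_probability_at_least P (1 - delta)
      [set w | halts_within a b k delta
                 (fun l => x1 l w) (fun l => x2 l w) (fun i l => y i l w)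
                 (C * ade_bound n_gt0 k delta (arm_mean nu))].
Proof.
(* The constant depends only on [a], [b] and [K]; the [+ 1] makes it positive. *)
exists (2 * count_const a b K + 1); split.
  by have := count_const_ge0 a b K; lra.
move=> n n_gt0 k delta nu /andP[k0 kK] d01 nu_ab gap0 d T P arm x1 x2 y model.
have ab := supported_in_lt n_gt0 nu_ab gap0.
have [G [mG Gacc PG]] := accurate_with_high_probability n_gt0 a_ge0 ab d01 nu_ab model.
exists G; split => // w /Gacc /= acc.
apply: (ade_halts_within n_gt0 a_ge0 ab k0 kK d01 _ gap0 acc) => i.
exact: mean_supported.
Qed.
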